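(* Let $p\ge5$ be a prime and $e\ge1$. Let $\mathcal M$ be an orientably-regular embedding of $K_{p[p^e]}$ with $G=\mathrm{Aut}^+(\mathcal M)$, let $H$ be the subgroup of $G$ of automorphisms preserving each of the $p$ parts setwise, and let $P$ be a Sylow $p$-subgroup of $G$. Suppose $H$ is abelian and $P$ has exponent $p^e$. Then $\mathcal M$ is isomorphic to one of the maps $\mathcal M_2(p,j)$, $j\in\mathbb Z^*_{p-1}$, and these maps are uniquely determined by $j$. Moreover, all of the maps $\mathcal M_2(p,j)$ are orientably-regular embeddings of $K_{p[p]}$; they are chiral, of type $\{p(p-1),p(p-1)\}$ if $p\equiv1\pmod4$ and $\{\frac{p(p-1)}2,p(p-1)\}$ if $p\equiv3\pmod4$.
   Context: $K_{m[n]}$ is the complete multipartite graph with $m$ parts of $n$ vertices each; an orientably-regular embedding is an orientable map with this underlying graph whose group $\mathrm{Aut}^+$ of orientation-preserving automorphisms acts regularly on arcs. Conjugation is $x^g=g^{-1}xg$. Let $t$ be a fixed generator of $\mathbb Z_p^*$ and $G_2(p)=\langle w,z,c,g\mid w^p=z^p=c^p=g^{p-1}=1,\ [w,z]=1,\ c^g=c^t,\ w^c=wz,\ z^c=z,\ w^g=w,\ z^g=z^t\rangle=\langle w,z\rangle\rtimes\langle c,g\rangle$, and $\mathcal M_2(p,j)=\mathcal M(G_2(p);wg^j,cg^{(p-1)/2})$. For a finite group $G$ generated by $a$ and an involution $b$ with $\langle a\rangle$ core-free, $\mathcal M(G;a,b)$ is the orientably-regular map with underlying graph the coset graph $\mathrm{Cos}(G,\langle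 a\rangle,b)$ (vertices right cosets $\langle a\rangle h$, arcs $(\langle a\rangle h,\langle a\rangle bh)$) and local rotation $(\langle a\rangle h,\langle a\rangle bh)\mapsto(\langle a\rangle h,\langle a\rangle bah)$. $\mathcal M(G;a,b)\cong\mathcal M(G;a',b')$ iff some automorphism of $G$ maps $a\mapsto a'$, $b\mapsto b'$; the map is chiral if not isomorphic to $\mathcal M(G;a^{-1},b)$; its type is $\{s,t\}$ with $s$ the order of $ab$ and $t$ the order of $a$. *)

(* Defs.v *)
From mathcomp Require Import all_boot all_order all_algebra all_fingroup all_solvable.

Set Implicit Arguments.
Unset Strict Implicit.
Unset Printing Implicit Defensive.

Local Open Scope group_scope.

(* An orientably-regular map is encoded, as in the paper, by M(G;a,b) where
   G = <<a, b>> (so G is generated by a and b), b is an involution and <[a]>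
   is core-free in G.  Vertices are the right cosets <[a]> :* h (h in G),
   arcs are indexed by h in G, arc h going from <[a]> :* h to <[a]> :* (b*h).
   Aut^+(M(G;a,b)) = G acting by right multiplication. *)

Section Maps.
Variable gT : finGroupType.
Implicit Types a b : gT.

Definition mapG a b : {group gT} := <<[set a; b]>>%G.

Definition orreg_map a b : Prop :=
  #[b] = 2%N /\ gcore <[a]> (mapG a b) = 1.

(* f : vertices -> vertices of K_{m[n]} = 'I_m * 'I_n (part = first coordinate)
   is an isomorphism from the underlying graph of M(G;a,b) onto K_{m[n]}:
   bijective on vertices, and the arc map is a bijection from the arcs of the
   map onto the ordered pairs of vertices lying in different parts. *)
Definition Kmn_embedding (m n : nat) a b (f : {set gT} -> 'I_m * 'I_n) : Prop :=
  [/\ {in rcosets <[a]> (mapG a b) &, injective f},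
      forall x, exists2 h, h \in mapG a b & f (<[a]> :* h) = x,
      {in mapG a b &, injective (fun h => (f (<[a]> :* h), f (<[a]> :* (b * h))))} &
      forall x y : 'I_m * 'I_n, x.1 != y.1 <->
        exists2 h, h \in mapG a b & (f (<[a]> :* h), f (<[a]> :* (b * h))) = (x, y)].

Definition part_stabilizer (m n : nat) a b (f : {set gT} -> 'I_m * 'I_n) : {set gT} :=
  [set x in mapG a b |
    [forall h in mapG a b, (f (<[a]> :* (h * x))).1 == (f (<[a]> :* h)).1]].

Definition map_type a b : nat * nat := (#[a * b], #[a]).

End Maps.

Definition map_iso (gT rT : finGroupType) (a b : gT) (a' b' : rT) : Prop :=
  exists f : {morphism mapG a b >-> rT},
    [/\ isom (mapG a b) (mapG a' b') f, f a = a' & f b = b'].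

(* Chiral: not isomorphic to its mirror image M(G;a^-1,b). *)
Definition chiral (gT : finGroupType) (a b : gT) : Prop := ~ map_iso a b a^-1 b.

(* Defining relations of G_2(p) (with t the fixed generator of Z_p^* ). *)
Definition G2_rels (gT : finGroupType) (p t : nat) (w z c g : gT) : bool :=
  [&& w ^+ p == 1, z ^+ p == 1, c ^+ p == 1, g ^+ p.-1 == 1, [~ w, z] == 1,
      c ^ g == c ^+ t, w ^ c == w * z, z ^ c == z, w ^ g == w & z ^ g == z ^+ t].

(* M(G;a,b) is isomorphic to M_2(p,j) = M(G_2(p); w g^j, c g^((p-1)/2)):
   there is an isomorphism from G_2(p) onto G = <<a,b>> sending the generators
   w, z, c, g of G_2(p) to elements w, z, c, g of G with a = w g^j and
   b = c g^((p-1)/2).  Such an isomorphism exists iff the images generate G,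
   satisfy the defining relations, and G is isomorphic to the presented group
   G_2(p) (MathComp's presentation predicate \isog Grp). *)
Definition isoM2 (gT : finGroupType) (p t j : nat) (a b : gT) : Prop :=
  exists w z c g : gT,
    [/\ <<[set w; z; c; g]>> = mapG a b,
        G2_rels p t w z c g,
        mapG a b \isog Grp (w : z : c : g :
            w ^+ p, z ^+ p, c ^+ p, g ^+ p.-1, [~ w, z],
            c ^ g = c ^+ t, w ^ c = w * z, z ^ c = z, w ^ g = w, z ^ g = z ^+ t),
        a = w * g ^+ j &
        b = c * g ^+ (p.-1 %/ 2)].

Definition unit_mod (n j : nat) : bool := (j < n) && coprime j n.

(* Main.v *)
(* Put A = <[a]>, let S be the stabilizer of the part containing the base vertex
   and H the kernel of the action on the parts.  Then G \ S = A b A, A and A^b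
   meet trivially, and counting in these double cosets gives |H| = p^(2e),
   P <| G, |P : H| = p and H = W x W^c, where W = <[w]> is the Sylow p-subgroup
   of A and c is b times the involution of A.  As H has rank 2, commutation with
   c maps H into H^p after two steps; expanding w^(c^p) = w binomially modulo
   H^(p^2) then gives [w, c]^p \in H^(p^2), which is impossible for e >= 2 when
   p >= 5.  For e = 1 the p'-part of A acts faithfully on P / H, so it has a
   generator g acting as t, and the relations of G_2(p) hold for w, [w, c], c, g.

   Conversely, the relations bound the order of the group they define by
   p^3 (p - 1), and permutations of F_p^2 attain this bound.  Since a^p acts on
   the derived subgroup as the power map t^j, both j and the chirality of
   M_2(p,j) can be read off from a. *)
Require Import Defs.
From mathcomp Require Import all_boot all_order all_algebra all_fingroup all_solvable.
From mathcomp Require Import ring zify.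

Set Implicit Arguments.
Unset Strict Implicit.
Unset Printing Implicit Defensive.

Local Open Scope group_scope.

(** * Auxiliary facts on products of subgroups *)

Lemma conjg_mul_swap (gT : finGroupType) (x y z : gT) :
  x ^ z = x * y -> z ^ x = z * y^-1.
Proof.
move=> xz; have E : x * z = z * (x * y) by rewrite -xz conjgE !mulgA mulgV mul1g.
by rewrite conjgE -[z * x](mulgK y) -(mulgA z) -E !mulgA mulVg mul1g.
Qed.

Lemma leq_card_mulg (gT : finGroupType) (B C : {group gT}) : (#|(B * C)%g| <= #|B| * #|C|)%N.
Proof. by rewrite mul_cardG leq_pmulr // cardG_gt0. Qed.

(** In [|B| |C| = |B C| |B :&: C|] the upper bounds on the factors meet the lower bound on the
    product, so every inequality is tight. This recovers exact orders from the order of a whole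
    group. *)
Lemma mulg_card_TI (gT : finGroupType) (B C : {group gT}) b n : (0 < b)%N -> (0 < n)%N ->
  (#|B| <= b -> #|C| <= n -> b * n <= #|(B * C)%g| -> [/\ #|B| = b, #|C| = n & (B :&: C = 1)%g])%N.
Proof.
move=> b0 n0 Bb Cn bn.
have E := mul_cardG B C.
have I1 := cardG_gt0 (B :&: C).
have [B0 C0] := (cardG_gt0 B, cardG_gt0 C).
have I : #|B :&: C| = 1%N.
  apply/eqP; rewrite eqn_leq I1 andbT -ltnS ltnNge; apply/negP=> I2.
  have := leq_mul Bb Cn; rewrite E; nia.
split; [nia|nia|].
by apply/eqP; rewrite trivg_card1 I.
Qed.

(** * Consequences of the defining relations *)

Section Relations.
Variables (gT : finGroupType) (p t : nat) (w z c g : gT).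
Hypotheses (pr : prime p) (rels : G2_rels p t w z c g).

Let K := <[z]> <*> <[c]>.
Let A := <[w]> <*> <[g]>.
Let G := <<[set w; z; c; g]>>.

Lemma G2_relsP : [/\ w ^+ p = 1, z ^+ p = 1, c ^+ p = 1 & g ^+ p.-1 = 1] /\
  [/\ commute w z, commute c z, commute w g & [/\ c ^ g = c ^+ t, z ^ g = z ^+ t & w ^ c = w * z]].
Proof.
case/and5P: rels => /eqP wp /eqP zp /eqP cp /eqP gp.
case/and5P=> /commgP cwz /eqP cg /eqP wc /eqP/conjg_fixP/commgP zc.
by case/andP=> /eqP/conjg_fixP/commgP wg /eqP zg; split; split.
Qed.

Lemma G2_conj_w : c ^ w = c * z^-1.
Proof. by case: G2_relsP => _ [cwz _ _ [_ _ wc]]; apply: conjg_mul_swap. Qed.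

Lemma G2_kernelM : K = <[z]> * <[c]>.
Proof.
case: G2_relsP => _ [_ ccz _ _]; rewrite /K norm_joinEl // cents_norm //.
by rewrite cent_cycle cycle_subG; apply/cent1P.
Qed.

Lemma G2_complM : A = <[w]> * <[g]>.
Proof.
case: G2_relsP => _ [_ _ cwg _]; rewrite /A norm_joinEl // cents_norm //.
by rewrite cent_cycle cycle_subG; apply/cent1P.
Qed.

Lemma G2_norm_kernel : A \subset 'N(K).
Proof.
case: G2_relsP => _ [cwz ccz cwg [cg zg wc]].
have zK : z \in K by rewrite mem_gen // inE cycle_id.
have cK : c \in K by rewrite mem_gen // inE cycle_id orbT.
have sub x : z ^ x \in K -> c ^ x \in K -> <[x]> \subset 'N(K).
  move=> zx cx; rewrite cycle_subG inE /K -genJ conjUg -!cycleJ gen_subG subUset.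
  by rewrite !cycle_subG zx cx.
have zw : z ^ w = z by apply/conjg_fixP/commgP/esym.
by rewrite join_subG !sub ?cg ?zg ?zw ?G2_conj_w ?groupX ?groupM ?groupV.
Qed.

Lemma G2_gen_prod : G = K * A.
Proof.
rewrite -norm_joinEr ?G2_norm_kernel //; apply/eqP; rewrite eqEsubset gen_subG.
rewrite !join_subG !cycle_subG !subUset !sub1set.
rewrite (mem_gen (_ : z \in [set w; z; c; g])) ?inE ?eqxx ?orbT //.
rewrite (mem_gen (_ : c \in [set w; z; c; g])) ?inE ?eqxx ?orbT //.
rewrite (mem_gen (_ : w \in [set w; z; c; g])) ?inE ?eqxx ?orbT //.
rewrite (mem_gen (_ : g \in [set w; z; c; g])) ?inE ?eqxx ?orbT //.
have [sK sA] := (joing_subl K A, joing_subr K A).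
rewrite !andbT (subsetP sK z) ?(subsetP sK c) ?(subsetP sA w) ?(subsetP sA g) //.
all: by rewrite mem_gen // inE cycle_id ?orbT.
Qed.

Lemma G2_leq_order : [/\ #[w] <= p, #[z] <= p, #[c] <= p & #[g] <= p.-1]%N.
Proof.
case: G2_relsP => -[wp zp cp gp] _.
have p1 := prime_gt1 pr.
by split; apply: dvdn_leq; rewrite ?order_dvdn ?wp ?zp ?cp ?gp //; case: p p1 => [|[]].
Qed.

(** The relations alone write [G] as a product of the four cyclic groups on [z], [c], [w], [g]. *)
Lemma G2_card_leq : (#|G| <= p * p * (p * p.-1))%N.
Proof.
case: G2_leq_order => ow oz oc og; rewrite G2_gen_prod.
apply: leq_trans (leq_card_mulg _ _) _; rewrite leq_mul //=.
  by rewrite -/K G2_kernelM; apply: leq_trans (leq_card_mulg _ _) _; rewrite leq_mul.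
by rewrite -/A G2_complM; apply: leq_trans (leq_card_mulg _ _) _; rewrite leq_mul.
Qed.

Hypothesis oG : #|G| = (p * p * (p * p.-1))%N.

(** Once [G] attains the order bound, each intermediate bound is attained too, which fixes the
    orders of the generators and makes the factors meet trivially. *)
Lemma G2_structure :
  [/\ #[w] = p, #[z] = p, #[c] = p & #[g] = p.-1] /\
  [/\ <[w]> :&: <[g]> = 1, <[z]> :&: <[c]> = 1 & K :&: A = 1].
Proof.
case: G2_leq_order => ow oz oc og.
have p1 := prime_gt1 pr.
have p0 : (0 < p)%N by apply: prime_gt0.
have q0 : (0 < p.-1)%N by case: (p) p1 => [|[]].
have lK : (#|K| <= p * p)%N.
  by rewrite -/K G2_kernelM; apply: leq_trans (leq_card_mulg _ _) _; rewrite leq_mul.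
have lA : (#|A| <= p * p.-1)%N.
  by rewrite -/A G2_complM; apply: leq_trans (leq_card_mulg _ _) _; rewrite leq_mul.
have := @mulg_card_TI _ (<[z]> <*> <[c]>)%G (<[w]> <*> <[g]>)%G (p * p) (p * p.-1).
rewrite !muln_gt0 p0 q0 => /(_ isT isT lK lA); rewrite -G2_gen_prod oG => /(_ (leqnn _)).
case=> eK eA TI.
have := @mulg_card_TI _ <[z]>%G <[c]>%G p p p0 p0 oz oc.
rewrite -G2_kernelM eK leqnn => /(_ isT)[ez ec tzc].
have := @mulg_card_TI _ <[w]>%G <[g]>%G p p.-1 p0 q0 ow og.
by rewrite -G2_complM eA leqnn => /(_ isT)[ew eg twg]; split; split.
Qed.

End Relations.

(** * The universal property of the presentation *)

Lemma joing_cycle4 (gT : finGroupType) (w z c g : gT) :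
  <[w]> <*> <[z]> <*> <[c]> <*> <[g]> = <<[set w; z; c; g]>>.
Proof.
have J (B : {set gT}) x : <<B>> <*> <[x]> = <<B :|: [set x]>>.
  by rewrite joing_idl joing_idr.
by rewrite -[<[w]>]/<<[set w]>> !J.
Qed.

Lemma G2_homP (gT : finGroupType) (G : {group gT}) (p t : nat) :
  reflect (exists w z c g, <<[set w; z; c; g]>> = G /\ G2_rels p t w z c g)
    (G \homg Grp (w : z : c : g :
            w ^+ p, z ^+ p, c ^+ p, g ^+ p.-1, [~ w, z],
            c ^ g = c ^+ t, w ^ c = w * z, z ^ c = z, w ^ g = w, z ^ g = z ^+ t)).
Proof.
apply: (iffP existsP) => [[[[[w z] c] g]]|[w [z [c [g [gen rels]]]]]] /=.
  rewrite !xpair_eqE /= joing_cycle4 => /andP[/eqP gen rels].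
  by exists w, z, c, g.
exists (w, z, c, g); rewrite !xpair_eqE /= joing_cycle4 gen eqxx.
exact: rels.
Qed.

Lemma expg_pair (gT rT : finGroupType) (x : gT) (y : rT) n :
  (x, y) ^+ n = (x ^+ n, y ^+ n).
Proof. by elim: n => [|n IHn]; rewrite ?expg0 // !expgS IHn. Qed.

Lemma G2_rels_pair (gT rT : finGroupType) p t (w z c g : gT) (w' z' c' g' : rT) :
  G2_rels p t w z c g -> G2_rels p t w' z' c' g' ->
  G2_rels p t (w, w') (z, z') (c, c') (g, g').
Proof.
case/and5P=> /eqP e1 /eqP e2 /eqP e3 /eqP e4 /and5P[/eqP e5 /eqP e6 /eqP e7 /eqP e8].
case/andP=> /eqP e9 /eqP e10.
case/and5P=> /eqP f1 /eqP f2 /eqP f3 /eqP f4 /and5P[/eqP f5 /eqP f6 /eqP f7 /eqP f8].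
case/andP=> /eqP f9 /eqP f10.
rewrite /G2_rels !expg_pair e1 e2 e3 e4 f1 f2 f3 f4 !eqxx /=.
apply/and5P; split; last (apply/andP; split); apply/eqP.
- exact: (f_equal2 pair e5 f5).
- exact: (f_equal2 pair e6 f6).
- exact: (f_equal2 pair e7 f7).
- exact: (f_equal2 pair e8 f8).
- exact: (f_equal2 pair e9 f9).
exact: (f_equal2 pair e10 f10).
Qed.

Lemma morphim_gen4 (aT rT : finGroupType) (D : {group aT}) (f : {morphism D >-> rT})
    (w z c g : aT) :
  w \in D -> z \in D -> c \in D -> g \in D ->
  f @* <<[set w; z; c; g]>> = <<[set f w; f z; f c; f g]>>.
Proof.
move=> Dw Dz Dc Dg.
by rewrite morphim_gen ?subUset ?sub1set ?Dw ?Dz ?Dc // !morphimU !morphim_set1.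
Qed.

(* The diagonal subgroup of the product of the two groups satisfies the relations,
   so it is no larger than the first group and hence projects isomorphically onto it. *)
Lemma G2_universal (gT rT : finGroupType) (H : {group rT}) p t (w z c g : gT)
    (w' z' c' g' : rT) : prime p ->
  G2_rels p t w z c g -> #|<<[set w; z; c; g]>>| = (p * p * (p * p.-1))%N ->
  G2_rels p t w' z' c' g' -> <<[set w'; z'; c'; g']>> = H ->
  H \homg <<[set w; z; c; g]>>.
Proof.
move=> pr rels oG rels' gen'.
have := G2_card_leq pr (G2_rels_pair rels rels').
pose K := <<[set (w, w'); (z, z'); (c, c'); (g, g')]>>.
have fK := morphim_gen4 [morphism of (@fst gT rT)]
  (in_setT (w, w')) (in_setT (z, z')) (in_setT (c, c')) (in_setT (g, g')).
have sK := morphim_gen4 [morphism of (@snd gT rT)]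
  (in_setT (w, w')) (in_setT (z, z')) (in_setT (c, c')) (in_setT (g, g')).
rewrite -gen' -oG => leK.
have isoKG : <<[set w; z; c; g]>> \isog K.
  rewrite isogEcard leK andbT -[X in X \homg _]fK.
  exact: morphim_homg (subsetT _).
rewrite -[X in X \homg _]sK.
apply: homg_trans (morphim_homg _ (subsetT _)) _.
by apply: isog_hom; rewrite isog_sym.
Qed.

(** * A permutation model of G_2(p) *)

Lemma eq_fst_snd (T U : Type) (x y : T * U) : x = y -> x.1 = y.1 /\ x.2 = y.2.
Proof. by move->. Qed.

Section Model.
Variables (p t : nat).
Hypotheses (pr : prime p) (tprim : primitive_root_of_unity p.-1 (t%:R : 'F_p)%R).

Import GRing.Theory.
Let V := ('F_p * 'F_p)%type.
Local Open Scope ring_scope.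

Let tu : (t%:R : 'F_p) \is a GRing.unit.
Proof.
rewrite -(@unitrX_pos _ _ p.-1) ?(prim_expr_order tprim) ?unitr1 //.
by case: p pr => [|[|[]]].
Qed.

(** On the affine plane over ['F_p], [w] and [z] are translations along the axes, [c] is a shear
    along the second axis and [g] scales the second coordinate. *)
Definition model_w (u : V) : V := (u.1 + 1, u.2).
Definition model_z (u : V) : V := (u.1, u.2 + 1).
Definition model_c (u : V) : V := (u.1, u.2 + u.1).
Definition model_g (u : V) : V := (u.1, u.2 * t%:R).

Lemma model_w_inj : injective model_w.
Proof. by move=> [x y] [x' y'] /eq_fst_snd[/= H ->]; rewrite (addIr _ H). Qed.
Lemma model_z_inj : injective model_z.
Proof. by move=> [x y] [x' y'] /eq_fst_snd[/= -> H]; rewrite (addIr _ H). Qed.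
Lemma model_c_inj : injective model_c.
Proof. by move=> [x y] [x' y'] /eq_fst_snd[/= -> H]; rewrite (addIr _ H). Qed.
Lemma model_g_inj : injective model_g.
Proof. by move=> [x y] [x' y'] /eq_fst_snd[/= -> H]; rewrite (mulIr tu H). Qed.

Let w := perm model_w_inj. Let z := perm model_z_inj.
Let c := perm model_c_inj. Let g := perm model_g_inj.

Let wX n x y : (w ^+ n)%g (x, y) = (x + n%:R, y).
Proof.
elim: n x y => [|n IHn] x y; first by rewrite expg0 perm1 addr0.
by rewrite expgS permM permE IHn /= -addrA -natr1 (addrC 1).
Qed.
Let zX n x y : (z ^+ n)%g (x, y) = (x, y + n%:R).
Proof.
elim: n x y => [|n IHn] x y; first by rewrite expg0 perm1 addr0.
by rewrite expgS permM permE IHn /= -addrA -natr1 (addrC 1).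
Qed.
Let cX n x y : (c ^+ n)%g (x, y) = (x, y + n%:R * x).
Proof.
elim: n x y => [|n IHn] x y; first by rewrite expg0 perm1 mul0r addr0.
by rewrite expgS permM permE IHn /= -addrA -natr1; congr (_, _); ring.
Qed.
Let gX n x y : (g ^+ n)%g (x, y) = (x, y * t%:R ^+ n).
Proof.
elim: n x y => [|n IHn] x y; first by rewrite expg0 perm1 expr0 mulr1.
by rewrite expgS permM permE IHn /= -mulrA -exprS.
Qed.

Let conjP (x y u : {perm V}) : (x * y)%g = (y * u)%g -> (x ^ y)%g = u.
Proof. by move=> E; rewrite conjgE E mulKg. Qed.

Lemma model_rels : G2_rels p t w z c g.
Proof.
have p0 : p%:R = 0 :> 'F_p by rewrite pchar_Fp_0.
have eX := (wX, zX, cX, gX).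
have w1 x y : w (x, y) = (x + 1, y) by rewrite permE.
have z1 x y : z (x, y) = (x, y + 1) by rewrite permE.
have c1 x y : c (x, y) = (x, y + x) by rewrite permE.
have g1 x y : g (x, y) = (x, y * t%:R) by rewrite permE.
have e1 := (w1, z1, c1, g1).
rewrite /G2_rels.
apply/and5P; split; last (apply/and5P; split; last (apply/andP; split)).
all: try by apply/eqP/permP=> -[x y]; rewrite ?eX ?perm1 ?p0 ?mul0r ?addr0 ?(prim_expr_order tprim) ?mulr1.
- by apply/commgP/permP=> -[x y]; rewrite !permM !e1.
- apply/eqP/conjP/permP=> -[x y]; rewrite !permM !e1 eX; congr (_, _); ring.
- apply/eqP/conjP/permP=> -[x y]; rewrite !permM !e1; congr (_, _); ring.
- apply/eqP/conjP/permP=> -[x y]; rewrite !permM !e1; congr (_, _); ring.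
- by apply/eqP/conjP/permP=> -[x y]; rewrite !permM !e1.
apply/eqP/conjP/permP=> -[x y]; rewrite !permM !e1 eX; congr (_, _); ring.
Qed.

Let Fp_nat_inj (i k : 'I_p) : i%:R = k%:R :> 'F_p -> i = k.
Proof.
move/(congr1 val); rewrite /= !val_Fp_nat // !modn_small //; exact: val_inj.
Qed.

(** The upper bound comes from the relations. For the lower one, the normal forms [w^i z^k c^l g^m]
    are shown to be distinct permutations by evaluating them at suitable points. *)
Lemma model_card : #|<<[set w; z; c; g]>>%g| = (p * p * (p * p.-1))%N.
Proof.
apply/eqP; rewrite eqn_leq (G2_card_leq pr model_rels) /=.
pose h (u : 'I_p * 'I_p * ('I_p * 'I_p.-1)) :=
  (w ^+ u.1.1 * z ^+ u.1.2 * c ^+ u.2.1 * g ^+ u.2.2)%g.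
have -> : (p * p * (p * p.-1))%N = #|[set: 'I_p * 'I_p * ('I_p * 'I_p.-1)]|.
  by rewrite cardsT !card_prod !card_ord.
have hinj : injective h.
  move=> [[i k] [l m]] [[i' k'] [l' m']] /permP E.
  have {}E (x y : 'F_p) : h (i, k, (l, m)) (x, y) = h (i', k', (l', m')) (x, y) by apply: E.
  move: E; rewrite /h /= => E.
  have {}E (x y : 'F_p) : (x + i%:R, (y + k%:R + l%:R * (x + i%:R)) * t%:R ^+ m) =
     (x + i'%:R, (y + k'%:R + l'%:R * (x + i'%:R)) * t%:R ^+ m').
    by move: (E x y); rewrite !permM !(wX, zX, cX, gX).
  have ei : i = i' by case: (eq_fst_snd (E 0 0)) => /addrI/Fp_nat_inj.
  rewrite -ei in E *.
  (* The second coordinates of the images of [(0, 1)] and [(0, 0)] differ by exactly [t^m]. *)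
  have em : m = m'.
    have [_ E0] := eq_fst_snd (E 0 0); have [_ E1] := eq_fst_snd (E 0 1).
    apply/val_inj/eqP; have := eq_prim_root_expr tprim m m'.
    rewrite !modn_small // => <-; apply/eqP.
    move: E0 E1; set a := t%:R ^+ m; set a' := t%:R ^+ m' => /= E0 E1.
    have -> : a = (1 + k%:R + l%:R * (0 + i%:R)) * a - (0 + k%:R + l%:R * (0 + i%:R)) * a by ring.
    by rewrite E0 E1; ring.
  rewrite -em in E *.
  have tm : (t%:R ^+ m : 'F_p) \is a GRing.unit by rewrite unitrX.
  have {}E (x y : 'F_p) : y + k%:R + l%:R * (x + i%:R) = y + k'%:R + l'%:R * (x + i%:R).
    by have [_ H] := eq_fst_snd (E x y); apply: (mulIr tm H).
  (* At [x = -i] the term in [l] vanishes and [k] is left; then [x = 1 - i] gives [l]. *)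
  have ek : k = k'.
    by move: (E (- i%:R) 0); rewrite addNr !mulr0 !addr0 !add0r => /Fp_nat_inj.
  rewrite -ek in E *.
  have := E (1 - i%:R) 0; rewrite subrK !mulr1 => /addrI/Fp_nat_inj -> //.
rewrite -(card_imset _ hinj); apply: subset_leq_card; apply/subsetP=> _ /imsetP[u _ ->].
by rewrite /h !groupM ?groupX ?mem_gen // !inE eqxx ?orbT.
Qed.

End Model.

Lemma G2_model p t : prime p -> primitive_root_of_unity p.-1 (t%:R : 'F_p)%R ->
  exists (gT : finGroupType) (w z c g : gT),
    G2_rels p t w z c g /\ #|<<[set w; z; c; g]>>| = (p * p * (p * p.-1))%N.
Proof.
move=> pr tprim; do 5 eexists; split; [exact: (model_rels pr tprim)|].
exact: model_card.
Qed.

(** This trades the presentation for an order. A group presented by the relations maps onto the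
    permutation model, so it attains the bound; conversely, a group that satisfies the relations and
    attains the bound has the universal property. *)
Lemma isoM2P p t j (gT : finGroupType) (a b : gT) :
  prime p -> primitive_root_of_unity p.-1 (t%:R : 'F_p)%R ->
  isoM2 p t j a b <-> exists w z c g : gT,
    [/\ <<[set w; z; c; g]>> = mapG a b, G2_rels p t w z c g,
        #|mapG a b| = (p * p * (p * p.-1))%N,
        a = w * g ^+ j & b = c * g ^+ (p.-1 %/ 2)].
Proof.
move=> pr tprim; split=> -[w [z [c [g [gen rels H ea eb]]]]].
  exists w, z, c, g; split=> //; apply/eqP; rewrite eqn_leq.
  have := G2_card_leq pr rels; rewrite gen => -> /=.
  have [rT [w' [z' [c' [g' [rels' <-]]]]]] := G2_model pr tprim.
  apply: leq_homg; rewrite H; apply/G2_homP.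
  by exists w', z', c', g'.
exists w, z, c, g; split=> //.
apply: intro_isoGrp; first by apply/G2_homP; exists w, z, c, g.
move=> rT L /G2_homP[w' [z' [c' [g' [gen' rels']]]]].
by rewrite -gen; apply: (G2_universal pr rels _ rels' gen'); rewrite gen.
Qed.

(** * The maps M_2(p,j) *)

Lemma prim_root_nat_eq p t i k : prime p ->
  primitive_root_of_unity p.-1 (t%:R : 'F_p)%R ->
  (t ^ i == t ^ k %[mod p])%N = (i == k %[mod p.-1]).
Proof.
move=> pr tprim; rewrite -(eq_prim_root_expr tprim) -!GRing.natrX.
by rewrite -(inj_eq val_inj) /= !val_Fp_nat.
Qed.

(** The power [t^((p-1)/2)] squares to 1 and is not 1 modulo [p], so it is -1. *)
Lemma prim_root_half p t : prime p -> (5 <= p)%N ->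
  primitive_root_of_unity p.-1 (t%:R : 'F_p)%R -> (p %| (t ^ (p.-1 %/ 2)).+1)%N.
Proof.
move=> pr p5 tprim.
have ph : p.-1 = (p.-1 %/ 2 * 2)%N by case: (even_prime pr) => [p2|]; lia.
have h1 : (t ^ (p.-1 %/ 2) != 1 %[mod p])%N.
  by rewrite -[1%N](expn0 t) (prim_root_nat_eq _ _ pr tprim) modn_small ?mod0n; lia.
have h2 : (t ^ (p.-1 %/ 2) * t ^ (p.-1 %/ 2) == 1 %[mod p])%N.
  by rewrite -expnD addnn -muln2 -ph -[1%N](expn0 t) (prim_root_nat_eq _ _ pr tprim) modnn mod0n.
move: h1 h2; set s := (t ^ _)%N => h1 h2.
have s0 : (0 < s)%N by case: s h2 {h1} => //; rewrite mod0n modn_small //; lia.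
have : (p %| s.-1 * s.+1)%N.
  have -> : (s.-1 * s.+1 = s * s - 1)%N by case: s s0 {h1 h2} => // s _; nia.
  by rewrite -eqn_mod_dvd // muln_gt0 s0.
rewrite Euclid_dvdM // => /orP[|//].
by rewrite -subn1 -eqn_mod_dvd // (negPf h1).
Qed.

(** The complement is counted instead: a pair inside one part is a part and two second coordinates,
    which [d] encodes. *)
Lemma card_diff_parts m n :
  #|[set q : ('I_m * 'I_n) * ('I_m * 'I_n) | q.1.1 != q.2.1]| = (m * n * (m.-1 * n))%N.
Proof.
pose d (r : 'I_m * 'I_n * 'I_n) := ((r.1.1, r.1.2), (r.1.1, r.2)).
have dinj : injective d by move=> [[x1 x2] x3] [[y1 y2] y3] [-> -> _ ->].
have := cardsC [set q : ('I_m * 'I_n) * ('I_m * 'I_n) | q.1.1 != q.2.1].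
have -> : ~: [set q : ('I_m * 'I_n) * ('I_m * 'I_n) | q.1.1 != q.2.1] = d @: setT.
  apply/setP=> -[[x1 x2] [y1 y2]]; rewrite !inE negbK /=.
  apply/eqP/imsetP=> [->|[r _ [-> _ -> _]] //].
  by exists (y1, x2, y2).
rewrite card_imset // cardsT !card_prod !card_ord => E.
apply/eqP; rewrite -(eqn_add2r (m * n * n)) E -mulnDr -mulSnr.
by case: (m) => [|m']; rewrite ?mul0n.
Qed.

(** With [p - 1 = 2 h], both [j] is odd and [h] is prime to [j + h], so only the parity of [j + h]
    matters. It depends on whether [h] is even, that is, on [p] modulo 4; this is the source of the
    two types. *)
Lemma gcdn_half_shift p j : prime p -> (5 <= p)%N -> unit_mod p.-1 j ->
  gcdn p.-1 (j + p.-1 %/ 2) = if p %% 4 == 1%N then 1%N else 2.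
Proof.
move=> pr p5 /andP[_]; rewrite coprime_sym; set h := (p.-1 %/ 2)%N.
have oddp : odd p by case: (even_prime pr) => // p2; move: p5; rewrite p2.
have half : p.-1 = (h * 2)%N by rewrite /h; lia.
rewrite half coprimeMl coprime2n => /andP[chj oddj].
have chjh : coprime h (j + h) by rewrite /coprime gcdnDr.
case: ifP => p4.
  have evh : ~~ odd h by lia.
  apply/eqP; change (coprime (h * 2) (j + h)).
  by rewrite coprimeMl chjh coprime2n oddD oddj (negPf evh).
have oddh : odd h by lia.
have [m em] : exists m, (j + h = m * 2)%N by exists (j + h)./2; lia.
rewrite em -muln_gcdl.
have -> : gcdn h m = 1%N by apply/eqP; move: chjh; rewrite em coprimeMr => /andP[].
by [].
Qed.

Section Properties.
Variables (gT : finGroupType) (p t : nat) (w z c g : gT) (j : nat).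
Hypotheses (pr : prime p) (p5 : (5 <= p)%N).
Hypothesis tprim : primitive_root_of_unity p.-1 (t%:R : 'F_p)%R.
Hypothesis uj : unit_mod p.-1 j.
Hypothesis rels : G2_rels p t w z c g.

Let K := (<[z]> <*> <[c]>)%G.
Let A := (<[w]> <*> <[g]>)%G.
Let G := <<[set w; z; c; g]>>%G.
Let a := w * g ^+ j.
Let h := (p.-1 %/ 2)%N.
Let b := c * g ^+ h.

Hypothesis oG : #|G| = (p * p * (p * p.-1))%N.

Let order_gens : [/\ #[w] = p, #[z] = p, #[c] = p & #[g] = p.-1].
Proof. by case: (G2_structure pr rels oG). Qed.

Let commute_gens : [/\ commute w z, commute c z & commute w g].
Proof. by case: (G2_relsP rels) => _ [? ? ? _]. Qed.

Let coprime_pp : coprime p p.-1.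
Proof. by rewrite prime_coprime // gtnNdvd //; lia. Qed.

Let half : p.-1 = (h * 2)%N.
Proof. by rewrite /h; case: (even_prime pr) => [p2|]; lia. Qed.

Let coprime_j : coprime p.-1 j.
Proof. by case/andP: uj => _; rewrite coprime_sym. Qed.

Lemma cycle_gj : <[g ^+ j]> = <[g]>.
Proof.
have [_ _ _ og] := order_gens.
by apply/esym/eqP; rewrite [_ == _]generator_coprime og.
Qed.

(** The commuting factors [w] and [g^j] of [a] have coprime orders [p] and [p - 1]. *)
Lemma G2_vertex_stab : <[a]> = A.
Proof.
have [ow _ _ og] := order_gens; have [_ _ cwg] := commute_gens.
have oj : #[g ^+ j] = p.-1 by rewrite orderE cycle_gj -orderE og.
rewrite /a cycleM ?ow ?oj // ?cycle_gj -?(G2_complM rels) //.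
exact: commuteX.
Qed.

Lemma G2_order_a : #[a] = (p * p.-1)%N.
Proof.
have [ow _ _ og] := order_gens; have [_ _ cwg] := commute_gens.
have oj : #[g ^+ j] = p.-1 by rewrite orderE cycle_gj -orderE og.
by rewrite /a orderM ?ow ?oj //; apply: commuteX.
Qed.

Lemma conj_gX x n : (x == z) || (x == c) -> x ^ (g ^+ n) = x ^+ (t ^ n).
Proof.
case: (G2_relsP rels) => _ [_ _ _ [cg zg _]] xzc.
have xg : x ^ g = x ^+ t by case/orP: xzc => /eqP->.
elim: n => [|n IHn]; first by rewrite expg0 conjg1 expg1.
by rewrite expgSr conjgM IHn conjXg xg -expgM expnS.
Qed.

(** Taking [p]-th powers kills [w] and fixes [g^j], so [a^p = g^j], which acts on both generators of
    the abelian group [K] by the same power. This makes [j] readable from [a] alone. *)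
Lemma G2_kernel_conj x : x \in K -> x ^ (a ^+ p) = x ^+ (t ^ j).
Proof.
have [ow _ _ og] := order_gens; have [_ ccz cwg] := commute_gens.
rewrite /= (G2_kernelM rels) => /mulsgP[_ _ /cycleP[m ->] /cycleP[n ->] ->].
have -> : a ^+ p = g ^+ j.
  rewrite /a expgMn; last exact: commuteX.
  rewrite -{1}ow expg_order mul1g -expgM -(prednK (prime_gt0 pr)) mulnS expgD.
  by rewrite mulnC expgM -og expg_order expg1n mulg1.
rewrite conjMg !conjXg !conj_gX ?eqxx ?orbT //.
rewrite [RHS]expgMn; last by apply/commuteX2/esym.
by rewrite -!expgM !(mulnC (t ^ j)%N).
Qed.

(** The quotient by [K] is the image of [A = <[a]>], hence cyclic. *)
Lemma G2_der1 : G^`(1) \subset K.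
Proof.
have nKA : A \subset 'N(K) by apply: G2_norm_kernel rels.
have GKA : G :=: K * A by apply: G2_gen_prod rels.
have nKG : G \subset 'N(K) by rewrite GKA; apply: mul_subG nKA; apply: normG.
apply: der1_min => //.
rewrite GKA quotientMidl -G2_vertex_stab quotient_abelian //.
exact: cycle_abelian.
Qed.

Lemma G2_z_der1 : z \in G^`(1) /\ z != 1.
Proof.
have [_ oz _ _] := order_gens.
case: (G2_relsP rels) => _ [_ _ _ [_ _ wc]].
split; last by rewrite -order_eq1 oz; case: (p) p5 => [|[]].
have -> : z = [~ w, c] by rewrite commgEl wc mulKg.
by rewrite mem_commg ?mem_gen // !inE eqxx ?orbT.
Qed.

(** The involution [g^h] inverts [c], because [t^h] is -1 modulo [p]; hence [c g^h] squares to 1. It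
    is nontrivial because [c] is not in [A]. *)
Lemma G2_b_involution : #[b] = 2%N.
Proof.
have [ow oz oc og] := order_gens.
have := conj_gX h (introT orP (or_intror (eqxx c))).
have -> : c ^+ (t ^ h) = c^-1.
  apply/eqP; rewrite eq_sym eq_invg_mul -expgS -order_dvdn oc.
  exact: prim_root_half.
move=> cgh.
have gh2 : g ^+ h * g ^+ h = 1 by rewrite -expgD addnn -muln2 -half -og expg_order.
have ghV : (g ^+ h)^-1 = g ^+ h by apply/eqP; rewrite eq_invg_mul gh2.
apply: nt_prime_order => //.
  have E : g ^+ h * c * g ^+ h = c^-1 by rewrite -cgh conjgE ghV mulgA.
  by rewrite expgS expg1 /b -mulgA (mulgA (g ^+ h)) E mulgV.
apply: contraTneq isT => b1.
have : c \in K :&: A.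
  rewrite inE {1}/K mem_gen ?inE ?cycle_id ?orbT //=.
  have -> : c = (g ^+ h)^-1 by apply/eqP; rewrite eq_mulgV1 invgK -/b b1.
  by rewrite groupV mem_gen // inE mem_cycle orbT.
case: (G2_structure pr rels oG) => _ [_ _ ->] /set1P c1.
by move: oc (p5); rewrite c1 order1 => <-.
Qed.

Let kernel_compl_TI : K :&: A = 1.
Proof. by case: (G2_structure pr rels oG) => _ []. Qed.

Let norm_kernel : G \subset 'N(K).
Proof.
by rewrite /G /= (G2_gen_prod rels) mul_subG ?normG // (G2_norm_kernel rels).
Qed.

Let gens_in : [/\ w \in G, z \in G, c \in G & g \in G].
Proof. by split; rewrite mem_gen // !inE eqxx ?orbT. Qed.

Let kernel_gens : z \in K /\ c \in K.
Proof. by split; rewrite mem_gen // inE cycle_id ?orbT. Qed.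

Let compl_gens : w \in A /\ g \in A.
Proof. by split; rewrite mem_gen // inE cycle_id ?orbT. Qed.

Lemma G2_conj_c_wX m : c ^ (w ^+ m) = c * (z^-1) ^+ m.
Proof.
have [cwz _ _] := commute_gens.
elim: m => [|k IHk]; first by rewrite conjg1 mulg1.
rewrite expgSr conjgM IHk conjMg conjXg conjVg (G2_conj_w rels).
have -> : z ^ w = z by apply/conjg_fixP/commgP/esym.
by rewrite -mulgA -expgS.
Qed.

(** As [g^h] lies in [A], it suffices to treat [A :^ c]. If [y] and [y^c] are both in [A], then
    [[y, c]] lies in [A] and in the normal subgroup [K], so [y] centralises [c]; only [y = 1]
    does. *)
Lemma G2_compl_TI : A :&: A :^ b = 1.
Proof.
have [ow oz oc og] := order_gens; have [cwz ccz cwg] := commute_gens.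
have [Gw Gz Gc Gg] := gens_in; have [Kz Kc] := kernel_gens; have [Aw Ag] := compl_gens.
have Agh : A :^ (g ^+ h) = A by rewrite conjGid // groupX.
suff TIc : A :&: A :^ c = 1.
  by rewrite /b conjsgM -{1}Agh -conjIg TIc conjs1g.
apply/trivgP/subsetP=> x /setIP[Ax /imsetP[y Ay ex]].
have cyc : [~ y, c] = 1.
  apply/set1P; rewrite -set1gE -kernel_compl_TI inE.
  have AG : A \subset G by rewrite /= (G2_gen_prod rels) mulG_subr.
  apply/andP; split; last by rewrite commgEl groupM ?groupV // -ex.
  rewrite commgEr groupM // memJ_norm ?groupV //.
  by apply: (subsetP norm_kernel); apply: (subsetP AG).
move: Ay; rewrite /= (G2_complM rels) => /mulsgP[_ _ /cycleP[m ->] /cycleP[n ->] ey].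
have cy : c ^ y = c by apply/conjg_fixP/eqP; rewrite -invg_comm cyc invg1.
move: cy; rewrite ey conjgM G2_conj_c_wX conjMg conjXg conjVg !conj_gX ?eqxx ?orbT // => cy.
(* For [y = w^m g^n], the equation [cy] splits into its components in [<[z]>] and [<[c]>]: the
   latter kills [g^n], the former then kills [w^m]. *)
have TI : <[z]> :&: <[c]> = 1 by case: (G2_structure pr rels oG) => _ [].
have zzz : (z ^+ (t ^ n))^-1 ^+ m \in <[z]> :&: <[c]>.
  rewrite inE groupX ?groupV ?mem_cycle //=.
  rewrite (_ : _ ^+ m = (c ^+ (t ^ n))^-1 * c) ?groupM ?groupV ?mem_cycle ?cycle_id //.
  by rewrite -{2}cy mulKg.
move: zzz cy; rewrite TI => /set1P zm1; rewrite zm1 mulg1 => cn.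
have n0 : g ^+ n = 1.
  apply/eqP; rewrite -order_dvdn og.
  have /eqP : c ^+ (t ^ n) = c ^+ 1 by rewrite cn.
  rewrite eq_expg_mod_order oc -(expn0 t) prim_root_nat_eq //.
  by rewrite mod0n.
move: zm1; rewrite -conj_gX ?eqxx // n0 conjg1 expVgn => /eqP.
rewrite eq_invg1 -order_dvdn oz -ow order_dvdn => /eqP wm1.
by rewrite ex ey n0 wm1 mulg1 conj1g.
Qed.

Lemma G2_mapG : mapG a b = G.
Proof.
have [Gw Gz Gc Gg] := gens_in; have [Aw Ag] := compl_gens.
apply/val_inj/eqP; rewrite /= eqEsubset !gen_subG !subUset !sub1set.
rewrite /a /b !groupM ?groupX //=.
set M := <<_>>.
have Ma : A \subset M.
  by rewrite -G2_vertex_stab cycle_subG mem_gen // !inE eqxx.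
have Mw : w \in M by apply: (subsetP Ma).
have Mg : g \in M by apply: (subsetP Ma).
have Mc : c \in M.
  by rewrite -[c](mulgK (g ^+ h)) groupM ?groupV ?groupX // mem_gen // !inE eqxx orbT.
case: (G2_relsP rels) => _ [_ _ _ [_ _ wc]].
have -> : z = [~ w, c] by rewrite commgEl wc mulKg.
by rewrite Mw Mg Mc groupR.
Qed.

(** The core of [<[a]>] is normalised by [b], so it lies in [A :&: A :^ b]. *)
Lemma G2_orreg_map : orreg_map a b.
Proof.
split; first exact: G2_b_involution.
apply/trivgP; rewrite -G2_compl_TI -G2_vertex_stab subsetI gcore_sub /=.
rewrite -sub_conjgV (normsP (gcore_norm _ _)) ?gcore_sub // groupV.
by rewrite mem_gen // !inE eqxx orbT.
Qed.

(** An isomorphism onto the mirror image would send [z] to a nontrivial element of the derived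
    subgroup on which [a^p] and [a^-p] both act as the power [t^j]. Then [p - 1] divides [2 j],
    hence 2, against [p >= 5]. *)
Lemma G2_chiral : chiral a b.
Proof.
have eG : G :=: mapG a b by rewrite G2_mapG.
move=> [f [isof fa fb]].
have [zG' z1] := G2_z_der1.
have [injf fG] := isomP isof.
have [Gw Gz Gc Gg] := gens_in.
have Ga : a \in mapG a b by rewrite mem_gen // !inE eqxx.
(* Inverting [a] does not change the generated group, so [f] is an automorphism and preserves the
   derived subgroup. *)
have GM : mapG a^-1 b :=: mapG a b.
  apply/eqP; rewrite eqEsubset !gen_subG !subUset !sub1set groupV.
  rewrite -(groupV (mapG a^-1 b)) !mem_gen // !inE ?eqxx ?orbT //.
have fz : f z \in G^`(1).
  have <- : f @* (mapG a b)^`(1) = G^`(1).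
    by rewrite morphim_der // fG GM -eG.
  by rewrite mem_morphim // -eG // (subsetP (der_sub 1 _)).
have := G2_kernel_conj (subsetP G2_der1 _ fz).
have Gap : a ^+ p \in mapG a b by apply: groupX.
have := G2_kernel_conj (subsetP G2_der1 _ zG').
rewrite eG in Gz Gw Gc Gg.
move/(congr1 f); rewrite morphJ // !morphX // fa.
set u := f z => uV ua.
have ou : #[u] = p by rewrite order_injm //; case: order_gens.
have : u ^+ (t ^ (j + j)) = u ^+ (t ^ 0).
  by rewrite expnD expgM -uV -conjXg -ua -conjgM expgVn mulgV conjg1 expn0.
move/eqP; rewrite eq_expg_mod_order ou prim_root_nat_eq // mod0n => jj.
have : (p.-1 %| 2)%N.
  by rewrite -(Gauss_dvdr 2 coprime_j) muln2 -addnn.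
by move/dvdn_leq=> /(_ isT); move: p5; case: (p) => [|[|[|[|]]]].
Qed.

(** The vertices are the cosets [A z^l c^k], and the exponent of [c] serves as the part. Arcs join
    different parts and are determined by their ends, so a count shows that every admissible pair
    occurs. *)
Lemma G2_embedding : exists f : {set gT} -> 'I_p * 'I_p, Kmn_embedding a b f.
Proof.
have [ow oz oc og] := order_gens.
have [Gw Gz Gc Gg] := gens_in; have [Kz Kc] := kernel_gens; have [Aw Ag] := compl_gens.
pose u (q : 'I_p * 'I_p) := z ^+ q.2 * c ^+ q.1.
pose o : 'I_p := Ordinal (prime_gt0 pr).
(* The default [(o, o)] is never reached on a vertex: by [cover], each vertex has the form
   [A :* u q]. *)
pose f (X : {set gT}) := odflt (o, o) [pick q | X == A :* u q].
have Gb : b \in G by rewrite /b groupM ?groupX.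
have uK q : u q \in K by rewrite /u groupM ?groupX.
have sKG : K \subset G by rewrite gen_subG subUset !cycle_subG Gz.
have sAG : A \subset G by rewrite gen_subG subUset !cycle_subG Gw.
have TI : <[z]> :&: <[c]> = 1 by case: (G2_structure pr rels oG) => _ [].
have uinj : injective u.
  move=> [k l] [k' l']; rewrite /u /= => /(congr1 (mulg ((z ^+ l')^-1))) E.
  have zc : (z ^+ l')^-1 * z ^+ l = c ^+ k' * (c ^+ k)^-1.
    by apply: (mulIg (c ^+ k)); rewrite mulgKV -mulgA E mulKg.
  have : (z ^+ l')^-1 * z ^+ l \in <[z]> :&: <[c]>.
    by rewrite inE {2}zc !groupM ?groupV ?mem_cycle.
  rewrite TI => /set1P z1; move: zc; rewrite {1}z1 => /esym/eqP.
  rewrite -eq_mulgV1 eq_expg_mod_order oc !modn_small // => /eqP kk.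
  have ll : l = l' :> nat.
    apply/eqP; move/eqP: z1 => //; rewrite -eq_mulVg1 eq_expg_mod_order oz.
    by rewrite !modn_small // eq_sym.
  by congr (_, _); apply: val_inj.
have uA q q' : A :* u q = A :* u q' -> q = q'.
  move/rcoset_eqP; rewrite mem_rcoset => uu.
  apply/uinj/eqP; rewrite eq_mulgV1 -in_set1 -set1gE -kernel_compl_TI.
  by rewrite inE uu groupM ?groupV ?uK.
have fu q : f (A :* u q) = q.
  rewrite /f; case: pickP => [q' /eqP/uA //|/(_ q)]; by rewrite eqxx.
have cover k : k \in G -> exists q, A :* k = A :* u q.
  rewrite /= (G2_gen_prod rels) -(normC (G2_norm_kernel rels)).
  case/mulsgP=> x y Ax; rewrite (G2_kernelM rels) => /mulsgP[_ _ /cycleP[l ->] /cycleP[m ->] ->] ->.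
  exists (Ordinal (ltn_pmod m (prime_gt0 pr)), Ordinal (ltn_pmod l (prime_gt0 pr))).
  by rewrite rcosetM (rcoset_id Ax) /u /= -{1}oz expg_mod_order -{1}oc expg_mod_order.
have finj k k' : k \in G -> k' \in G -> f (A :* k) = f (A :* k') -> A :* k = A :* k'.
  by move=> /cover[q ->] /cover[q' ->]; rewrite !fu => ->.
pose arc k := (f (A :* k), f (A :* (b * k))).
have arc_inj : {in G &, injective arc}.
  move=> k k' Gk Gk' [E1 E2].
  apply/eqP; rewrite eq_sym eq_mulgV1 -in_set1 -set1gE -G2_compl_TI inE.
  rewrite -mem_rcoset (finj _ _ Gk Gk' E1) rcoset_refl /= mem_conjg.
  have : b * k' \in A :* (b * k) by rewrite (finj _ _ (groupM Gb Gk) (groupM Gb Gk') E2) rcoset_refl.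
  by rewrite mem_rcoset conjgE invgK invMg !mulgA.
have arc_parts k : k \in G -> (arc k).1.1 != (arc k).2.1.
  move=> Gk; apply/eqP => /= E.
  have [q Eq] := cover k Gk; have [q' Eq'] := cover _ (groupM Gb Gk).
  move: E; rewrite Eq Eq' !fu => E.
  (* If an arc stayed inside a part, then [b], and with it [c], would lie in the group [<[z]> A];
     the trivial intersections exclude this. *)
  have nzA : A \subset 'N(<[z]>).
    rewrite gen_subG subUset !cycle_subG !inE /= -!cycleJ !cycle_subG.
    case: (G2_relsP rels) => _ [cwz _ _ [_ zg _]].
    have -> : z ^ w = z by apply/conjg_fixP/commgP/esym.
    by rewrite zg cycle_id mem_cycle.
  pose S := (<[z]> <*> A)%G.
  have SA x : x \in A -> x \in S by apply/subsetP/joing_subr.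
  have Sb : b \in S.
    have /rcosetP[x Ax kx] : k \in A :* u q by rewrite -Eq rcoset_refl.
    have /rcosetP[y Ay bky] : b * k \in A :* u q' by rewrite -Eq' rcoset_refl.
    have -> : b = y * (z ^+ q'.2 * (z ^+ q.2)^-1) * x^-1.
      by apply: (mulIg k); rewrite bky kx /u E !mulgA !mulgKV.
    have Sz i : z ^+ i \in S by rewrite groupX // (subsetP (joing_subl _ _)) ?cycle_id.
    by rewrite groupM ?groupV ?(SA _ Ax) // groupM ?(SA _ Ay) // groupM ?groupV.
  have : c \in S by rewrite -[c](mulgK (g ^+ h)) groupM ?groupV ?(SA _ (groupX _ Ag)).
  rewrite /= norm_joinEr // => /mulsgP[x y zx Ay cxy].
  have y1 : y = 1.
    apply/set1P; rewrite -set1gE -kernel_compl_TI inE Ay andbT.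
    rewrite -(mulKg x y) -cxy groupM ?groupV //.
    by case/cycleP: zx => i ->; rewrite groupX.
  have : c \in <[z]> :&: <[c]> by rewrite inE cycle_id cxy y1 mulg1 zx.
  by rewrite TI => /set1P c1; move: oc (p5); rewrite c1 order1 => <-.
have arc_img : arc @: G = [set q | q.1.1 != q.2.1].
  apply/eqP; rewrite eqEcard; apply/andP; split.
    by apply/subsetP=> _ /imsetP[k Gk ->]; rewrite inE arc_parts.
  rewrite card_in_imset // oG.
  by rewrite card_diff_parts (mulnC p.-1).
exists f; rewrite /Kmn_embedding G2_mapG G2_vertex_stab; split=> //.
- by move=> _ _ /rcosetsP[k Gk ->] /rcosetsP[k' Gk' ->]; apply: finj.
- by move=> q; exists (u q); rewrite ?fu // (subsetP sKG).
move=> x y; have := congr1 (fun B : {set _} => (x, y) \in B) arc_img; rewrite inE /= => <-.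
split=> [/imsetP[k Gk ->]|[k Gk <-]]; [by exists k|exact: imset_f].
Qed.

(** The commutator of [k] and [w^m] is a power of [z] commuting with both, so the power expands with
    a correction of exponent ['C(p, 2)], which [p] divides as [p] is odd. *)
Lemma G2_exponent m k : k \in K -> (w ^+ m * k) ^+ p = 1.
Proof.
have [ow oz oc _] := order_gens; have [cwz ccz _] := commute_gens.
rewrite /= (G2_kernelM rels) => /mulsgP[_ _ /cycleP[i ->] /cycleP[l ->] ->].
have czX n n' : commute (c ^+ n) (z ^+ n') by apply: commuteX2.
have wzX n n' : commute (w ^+ n) (z ^+ n') by apply: commuteX2.
have com : [~ z ^+ i * c ^+ l, w ^+ m] = (z ^+ (m * l))^-1.
  rewrite commgEl conjMg conjXg conjXg G2_conj_c_wX.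
  have -> : z ^ (w ^+ m) = z by apply/conjg_fixP/commgP/commuteX/esym.
  rewrite expgMn; last by rewrite expVgn; apply/commuteV/commuteX.
  by rewrite -expgM (mulgA (z ^+ i)) mulKg expVgn.
rewrite expMg_Rmul com; last 2 first.
- by apply: commuteV; apply/commute_sym/commuteM; [apply: commuteX2|apply/commute_sym/czX].
- by apply/commuteV/wzX.
rewrite expgMn; last by apply/commute_sym/czX.
rewrite expVgn -!expgM.
have /dvdnP[n ->] : (p %| 'C(p, 2))%N by apply: prime_dvd_bin => //; lia.
case: (G2_relsP rels) => -[wp zp cp _] _.
rewrite mulnA !(mulnC _ p) !expgM wp zp cp !expg1n !mulg1.
by rewrite mulgV.
Qed.

Lemma G2_order_gjh : #[g ^+ (j + h)] = if p %% 4 == 1%N then p.-1 else (p.-1 %/ 2)%N.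
Proof.
have [_ _ _ og] := order_gens.
by rewrite orderXgcd og gcdn_half_shift //; case: ifP; rewrite ?divn1.
Qed.

(** Modulo [K], [a b] is [y = w g^(j+h)], of order [p d]. This bounds the order of [a b] below
    because [K :&: A = 1]. Conversely, [(a b)^d] lies in [w^d K], whose elements have trivial [p]-th
    power. *)
Lemma G2_map_type :
  map_type a b = (if p %% 4 == 1%N then (p * p.-1)%N else (p * p.-1 %/ 2)%N, (p * p.-1)%N).
Proof.
have [ow oz oc og] := order_gens; have [cwz ccz cwg] := commute_gens.
have [Kz Kc] := kernel_gens; have [Aw Ag] := compl_gens.
rewrite /map_type G2_order_a; congr (_, _).
set d := #[g ^+ (j + h)].
have -> : (if p %% 4 == 1%N then p * p.-1 else p * p.-1 %/ 2)%N = (p * d)%N.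
  by rewrite /d G2_order_gjh; case: ifP => // _; rewrite half mulnA !mulnK.
pose y := w * g ^+ (j + h); pose k := c ^ (g ^+ h).
have nKA := subsetP (G2_norm_kernel rels).
have Kk : k \in K by rewrite memJ_norm // nKA // groupX.
have Ay : y \in A by rewrite groupM ?groupX.
have ab : a * b = y * k.
  by rewrite /a /b /y /k expgD conjgE !mulgA mulgK.
have oy : #[y] = (p * d)%N.
  rewrite /y orderM ?ow //; first exact: commuteX.
  apply: coprime_dvdr coprime_pp; rewrite -og; apply: orderXdvd.
have ymod m : exists2 k', k' \in K & (a * b) ^+ m = y ^+ m * k'.
  rewrite ab; elim: m => [|m [k' Kk' IHm]]; first by exists 1; rewrite ?mulg1.
  exists (k' ^ y * k); first by rewrite groupM // memJ_norm // nKA.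
  by rewrite !expgSr IHm; move: (y) (k) => u v; rewrite conjgE !mulgA mulgK.
apply/eqP; rewrite eqn_dvd order_dvdn; apply/andP; split.
  have [k' Kk' E] := ymod d.
  have yd : y ^+ d = w ^+ d.
    by rewrite /y expgMn /d ?expg_order ?mulg1 //; apply: commuteX.
  by rewrite mulnC expgM E yd G2_exponent.
have [k' Kk' E] := ymod #[a * b].
rewrite -oy order_dvdn -in_set1 -set1gE -kernel_compl_TI inE andbC groupX //=.
have -> : y ^+ #[a * b] = k'^-1 by apply/eqP; rewrite eq_mulgV1 invgK -E expg_order.
by rewrite groupV.
Qed.

End Properties.

(** * The parts of a complete multipartite map *)

Section MapGeometry.
Variables (gT : finGroupType) (a b : gT) (m n : nat) (f : {set gT} -> 'I_m * 'I_n).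
Hypothesis emb : Kmn_embedding a b f.
Hypothesis n0 : (0 < n)%N.

Let A := <[a]>%G.
Let G := mapG a b.
Definition part (x : gT) : 'I_m := (f (<[a]> :* x)).1.

Lemma vertex_stab_sub : A \subset G.
Proof. by rewrite cycle_subG mem_gen // !inE eqxx. Qed.

Lemma flip_mem : b \in G.
Proof. by rewrite mem_gen // !inE eqxx orbT. Qed.

(** Vertices in different parts are joined by some arc [k], with [k] in [A x] and [y] in [A b k];
    eliminating [k] leaves the double coset. *)
Lemma part_adj x y : x \in G -> y \in G ->
  (part x != part y) = (y * x^-1 \in <[a]> :* b * <[a]>).
Proof.
case: emb => finj _ _ fadj Gx Gy.
have inj u v : u \in G -> v \in G -> f (<[a]> :* u) = f (<[a]> :* v) -> <[a]> :* u = <[a]> :* v.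
  by move=> Gu Gv; apply: finj; rewrite mem_rcosets mulSGid ?vertex_stab_sub.
apply/idP/idP=> [/fadj[k Gk [E1 E2]]|/mulsgP[_ d /rcosetP[c Ac ->] Ad E]].
  have {E1} : k \in <[a]> :* x by rewrite -(inj _ _ Gk Gx E1) rcoset_refl.
  have {E2} : y \in <[a]> :* (b * k) by rewrite (inj _ _ _ Gy E2) ?rcoset_refl ?groupM ?flip_mem.
  case/rcosetP=> c Ac -> /rcosetP[d Ad ->].
  by rewrite !mulgA mulgK mem_mulg // mem_rcoset mulgK.
have sAG := subsetP vertex_stab_sub.
apply/(fadj (f (<[a]> :* x)) (f (<[a]> :* y))); exists (d * x); first exact: groupM (sAG _ Ad) Gx.
congr (_, _); congr f; first by rewrite rcosetM rcoset_id.
have -> : y = c * (b * (d * x)) by rewrite -[y](mulgKV x) E !mulgA.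
by rewrite [RHS]rcosetM (rcoset_id Ac).
Qed.

(** Adjacency depends only on [y x^-1], which right multiplication preserves; hence the parts are
    blocks. *)
Lemma part_mulr x y u : x \in G -> y \in G -> u \in G ->
  (part (x * u) == part (y * u)) = (part x == part y).
Proof.
move=> Gx Gy Gu; apply: negb_inj; rewrite !part_adj ?groupM //.
by rewrite invMg mulgA mulgK.
Qed.

(** Since the parts are blocks, carrying the base vertex into its own part means stabilising that
    part setwise. *)
Definition base_part := [set x in mapG a b | part x == part 1].

Lemma base_part_group_set : group_set base_part.
Proof.
apply/group_setP; split; first by rewrite inE group1 eqxx.
move=> x y; rewrite !inE => /andP[Gx px] /andP[Gy /eqP <-].
by rewrite groupM //= -{2}[y]mul1g part_mulr.
Qed.
Canonical base_part_group := Group base_part_group_set.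
Let S := base_part_group.

Lemma part_eq x y : x \in G -> y \in G -> (part x == part y) = (x * y^-1 \in S).
Proof.
move=> Gx Gy; rewrite inE groupM ?groupV //=.
by rewrite -(part_mulr (u := y^-1)) ?groupV // mulgV.
Qed.

Lemma base_part_sub : S \subset G.
Proof. by apply/subsetP=> x /setIdP[]. Qed.

Lemma vertex_stab_base_part : A \subset S.
Proof.
apply/subsetP=> x Ax; rewrite inE (subsetP vertex_stab_sub) //=.
by rewrite /part (rcoset_id Ax) rcoset1 eqxx.
Qed.

Lemma base_part_compl : G :\: S = <[a]> :* b * <[a]>.
Proof.
apply/setP=> x; rewrite in_setD; apply/andP/idP => [[nSx Gx]|xAbA].
  by rewrite -(mulg1 x) -invg1 -part_adj // eq_sym part_eq ?group1 ?invg1 ?mulg1.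
have Gx : x \in G.
  case/mulsgP: xAbA => _ v /rcosetP[u Au ->] Av ->.
  by rewrite !groupM ?flip_mem // (subsetP vertex_stab_sub).
split=> //; move: xAbA.
by rewrite -(mulg1 x) -invg1 -part_adj // eq_sym part_eq ?group1.
Qed.

(** Such an element fixes both ends of the base arc, and an arc is determined by its ends. *)
Lemma arc_stab_TI : A :&: A :^ b = 1.
Proof.
case: emb => _ _ arcinj _; apply/trivgP/subsetP=> x /setIP[Ax Abx].
rewrite inE; apply/eqP/arcinj; rewrite ?group1 ?(subsetP vertex_stab_sub) //.
congr (_, _); congr f; first by rewrite (rcoset_id Ax) rcoset1.
have Abxb : b * x * b^-1 \in A by move: Abx; rewrite mem_conjg conjgE invgK mulgA.
by rewrite mulg1 -[b * x](mulgKV b) rcosetM (rcoset_id Abxb).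
Qed.

Lemma part_stabilizerE : part_stabilizer a b f = gcore S G.
Proof.
apply/setP=> x; rewrite inE; apply/andP/bigcapP=> [[Gx /forallP px] y Gy|Sx].
  move: (px y); rewrite Gy /= -/(part _) -/(part y) (part_eq (groupM Gy Gx) Gy).
  by rewrite mem_conjg conjgE invgK mulgA.
have Gx : x \in G by have := Sx 1 (group1 _); rewrite conjsg1; apply: (subsetP base_part_sub).
split=> //; apply/forallP=> y; apply/implyP=> Gy.
rewrite -/(part _) -/(part y) (part_eq (groupM Gy Gx) Gy).
by have := Sx y Gy; rewrite mem_conjg conjgE invgK mulgA.
Qed.

Lemma card_arcs : #|G| = (m * n * (m.-1 * n))%N.
Proof.
case: emb => _ _ arcinj fadj.
pose arc k := (f (<[a]> :* k), f (<[a]> :* (b * k))).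
have <- : #|arc @: G| = #|G| by rewrite card_in_imset.
have -> : arc @: G = [set q | q.1.1 != q.2.1].
  apply/setP=> -[x y]; rewrite [RHS]inE /=.
  apply/imsetP/idP=> [[k Gk E]|/(fadj x y)[k Gk E]]; last by exists k.
  by apply/(fadj x y); exists k.
exact: card_diff_parts.
Qed.

Hypothesis m0 : (0 < m)%N.

Lemma card_vertex_stab : #|A| = (m.-1 * n)%N.
Proof.
case: emb => finj fsurj _ _.
have E : (#|G : A| = m * n)%N.
  rewrite /indexg -(card_in_imset finj).
  have -> : f @: rcosets A G = setT.
    apply/setP=> x; rewrite inE; have [h Gh <-] := fsurj x.
    by apply: imset_f; rewrite mem_rcosets mulSGid ?vertex_stab_sub.
  by rewrite cardsT card_prod !card_ord.
have := Lagrange vertex_stab_sub; rewrite E card_arcs [LHS]mulnC.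
by move/eqP; rewrite eqn_pmul2l ?muln_gt0 ?m0 // => /eqP.
Qed.

(** The double coset [A b A] is a translate of [A^b A], whose factors meet trivially, so it has
    [|A|^2] elements. *)
Lemma card_base_compl : #|G :\: S| = (m.-1 * n * (m.-1 * n))%N.
Proof.
have -> : G :\: S = b *: (A :^ b * A)%g.
  rewrite base_part_compl conjsgE !mulgA mulg_set1 mulgV.
  by rewrite -set1gE mul1g.
rewrite card_lcoset; have := mul_cardG (A :^ b) A.
by rewrite setIC arc_stab_TI cards1 muln1 cardJg card_vertex_stab.
Qed.

Lemma card_base_part : #|S| = (m.-1 * n * n)%N.
Proof.
have := cardsID S G; rewrite card_base_compl card_arcs.
rewrite (setIidPr base_part_sub); case: (m) m0 => // m' _ /=; nia.
Qed.

End MapGeometry.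

(** * p-subgroups of a subgroup of prime index p *)

Section SylowIndex.
Variables (gT : finGroupType) (G S T : {group gT}) (p : nat).
Hypotheses (sSG : S \subset G) (iS : #|G : S| = p) (pr : prime p).
Hypotheses (sTS : T \subset S) (pT : p.-group T).

(** For [k] outside [S], the set [S k T] avoids [S], so it has at most [|S| (p - 1)] elements. Hence
    [T :&: S^k] has index below [p] in [T]; as a power of [p] this index is 1. *)
Lemma pgroup_sub_gcore : T \subset gcore S G.
Proof.
apply/bigcapsP=> k Gk; case Sk: (k \in S).
  by rewrite conjGid // ?sTS.
have := mul_cardG (S :^ k) T; rewrite cardJg => E.
have lST : (#|S :^ k * T|%g <= #|S| * p.-1)%N.
  have sub : k *: (S :^ k * T)%g \subset G :\: S.
    rewrite conjsgE !mulgA mulg_set1 mulgV -set1gE mul1g.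
    apply/subsetP=> _ /mulsgP[_ v /rcosetP[u Su ->] Tv ->].
    have [Gu Sv] := (subsetP sSG _ Su, subsetP sTS _ Tv).
    by rewrite inE (groupM (groupM Gu Gk)) ?(subsetP sSG v) // groupMr // groupMl // Sk.
  have := subset_leq_card sub; rewrite card_lcoset => /leq_trans-> //.
  have := cardsID S G; rewrite (setIidPr sSG) -(Lagrange sSG) iS.
  move=> H; rewrite -(leq_add2l #|S|) H -mulnS prednK ?prime_gt0 //.
have iT : (#|T : S :^ k :&: T| <= p.-1)%N.
  rewrite -(leq_pmul2l (cardG_gt0 S)); apply: leq_trans lST.
  rewrite -(leq_pmul2r (cardG_gt0 (S :^ k :&: T))) -mulnA.
  by rewrite [(#|T : _| * _)%N]mulnC Lagrange ?subsetIr // E.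
have : p.-nat #|T : S :^ k :&: T| by apply: pnat_dvd pT; apply: dvdn_indexg.
case/p_natP=> // -[|m] em.
  have := Lagrange (subsetIr (S :^ k) T); rewrite em muln1 => eT.
  by apply/setIidPr/eqP; rewrite eqEcard subsetIr eT leqnn.
move: iT; rewrite em leqNgt => /negP[]; rewrite prednK ?prime_gt0 //.
by rewrite expnS leq_pmulr // expn_gt0 prime_gt0.
Qed.

End SylowIndex.

Lemma mul_rearrange m n q : (m * n * (q * n) = q * n * n * m)%N.
Proof. by lia. Qed.

Lemma mul_rearrange2 m n q : (m * n * (q * n) = m * (n * n) * q)%N.
Proof. by lia. Qed.

(** * The kernel on the parts and the Sylow subgroup, for a prime number of parts *)

Section PrimeParts.
Variables (gT : finGroupType) (a b : gT) (p e : nat) (f : {set gT} -> 'I_p * 'I_(p ^ e)).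
Hypotheses (pr : prime p) (emb : Kmn_embedding a b f).

Let n := (p ^ e)%N.
Let A := <[a]>%G.
Let G := mapG a b.
Let S := base_part_group emb.
Let H := [group of gcore S G].
Let w := a.`_p.
Let g := a.`_p^'.
Variable P : {group gT}.
Hypothesis sylP : p.-Sylow(G) P.

Let p0 : (0 < p)%N. Proof. exact: prime_gt0. Qed.
Let n0 : (0 < n)%N. Proof. by rewrite expn_gt0 p0. Qed.
Let q0 : (0 < p.-1)%N. Proof. by case: p pr => [|[|[]]]. Qed.

Let sAG : A \subset G. Proof. exact: vertex_stab_sub. Qed.
Let sSG : S \subset G. Proof. exact: base_part_sub. Qed.
Let sAS : A \subset S. Proof. exact: vertex_stab_base_part. Qed.
Let oA : #|A| = (p.-1 * n)%N. Proof. exact: (card_vertex_stab emb n0 p0). Qed.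
Let oS : #|S| = (p.-1 * n * n)%N. Proof. exact: (card_base_part emb n0 p0). Qed.
Let oG : #|G| = (p * n * (p.-1 * n))%N. Proof. exact: card_arcs emb. Qed.

Let iS : #|G : S| = p.
Proof.
apply/eqP; rewrite -(eqn_pmul2l (cardG_gt0 S)) Lagrange // oG oS.
by rewrite mul_rearrange.
Qed.

Let pn : p.-nat n. Proof. by rewrite pnatX pnat_id. Qed.
Let p'q : p^'.-nat p.-1.
Proof. by rewrite p'natE // gtnNdvd // prednK. Qed.

Lemma order_constt_vertex : #[w] = n /\ #[g] = p.-1.
Proof.
rewrite !order_constt orderE [#|<[a]>|]oA.
rewrite !partnM // (part_pnat_id pn) (part_p'nat p'q) mul1n; split=> //.
by rewrite (part_pnat_id p'q) part_p'nat ?muln1 // pnatNK.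
Qed.

Lemma p_sub_kernel (T : {group gT}) : T \subset S -> p.-group T -> T \subset H.
Proof. by move=> sTS pT; apply: pgroup_sub_gcore sTS pT. Qed.

Lemma w_sub_vertex : <[w]> \subset A.
Proof. by rewrite cycle_subG cycle_constt. Qed.

Lemma w_sub_kernel : <[w]> \subset H.
Proof.
apply: p_sub_kernel; first exact: subset_trans w_sub_vertex sAS.
by rewrite /pgroup -orderE; have [-> _] := order_constt_vertex.
Qed.

Lemma kernel_sub : H \subset S. Proof. exact: gcore_sub. Qed.

Lemma kernel_normal : H <| G. Proof. exact: gcore_normal. Qed.

(** One inclusion holds because [w] lies in the core [H] of [S]. For the other, [A b A] is contained
    in [S k A], so [|A|^2 <= |S| |A| / |A :&: S^k|], and [|S| / |A| = n]. *)
Lemma vertex_stab_conj k : k \in G -> k \notin S -> A :&: S :^ k = <[w]>.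
Proof.
move=> Gk nSk; have [ow _] := order_constt_vertex.
apply/esym/eqP; rewrite eqEcard subsetI w_sub_vertex -orderE ow.
rewrite (subset_trans w_sub_kernel); last exact: bigcap_inf.
rewrite -(leq_pmul2l (_ : 0 < p.-1 * n * (p.-1 * n))%N) ?muln_gt0 ?q0 ?n0 //.
have := mul_cardG (S :^ k) A; rewrite cardJg oA oS setIC => E.
rewrite (_ : p.-1 * n * (p.-1 * n) * n = p.-1 * n * n * (p.-1 * n))%N; last by rewrite mulnAC.
rewrite E leq_pmul2r ?cardG_gt0 // -(card_base_compl emb) //.
rewrite -(card_lcoset (S :^ k * A) k); apply: subset_leq_card.
rewrite conjsgE !mulgA mulg_set1 mulgV -set1gE mul1g base_part_compl.
have : k \in G :\: S by rewrite inE nSk.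
rewrite base_part_compl => /mulsgP[_ y /rcosetP[x Ax ->] Ay ->].
apply/subsetP=> _ /mulsgP[_ v /rcosetP[u Au ->] Av ->].
have -> : u * b * v = (u * x^-1 * (x * b * y)) * (y^-1 * v) by rewrite !mulgA mulgKV mulgK.
by rewrite mem_mulg ?groupM ?groupV // mem_rcoset mulgK groupM ?groupV ?(subsetP sAS).
Qed.

Lemma flip_notin : b \notin S.
Proof.
have : b \in G :\: S.
  by rewrite base_part_compl -{1}[b]mulg1 mem_mulg ?rcoset_refl ?group1.
by case/setDP.
Qed.

Lemma kernel_vertex_stab : A :&: H = <[w]>.
Proof.
apply/eqP; rewrite eqEsubset subsetI w_sub_vertex w_sub_kernel !andbT.
rewrite -(vertex_stab_conj (flip_mem a b) flip_notin) setIS //.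
exact: bigcap_inf (flip_mem a b).
Qed.

(** A Sylow p-subgroup of [S] has order [n^2] and lies in the core. Conversely, [A H] fits into [S]
    and [A :&: H = <[w]>] has order [n]. *)
Lemma card_part_kernel : #|H| = (n * n)%N.
Proof.
have [ow og] := order_constt_vertex.
have [T sylT] := Sylow_exists p S.
have [sTS pT _] := and3P sylT.
have sTH : T \subset H by apply: p_sub_kernel.
have oT : #|T| = (n * n)%N.
  rewrite (card_Hall sylT) oS -mulnA partnM ?muln_gt0 ?q0 ?n0 // (part_p'nat p'q).
  by rewrite mul1n part_pnat_id // pnatM pn.
apply/eqP; rewrite eqn_leq -{2}oT subset_leq_card // andbT.
have sub : (A * H)%g \subset S by rewrite mul_subG ?sAS ?kernel_sub.
have := mul_cardG A H; rewrite kernel_vertex_stab -orderE ow oA => E.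
rewrite -(leq_pmul2l (_ : 0 < p.-1 * n)%N) ?muln_gt0 ?q0 // E mulnA -oS leq_pmul2r //.
exact: subset_leq_card.
Qed.

Lemma kernel_pgroup : p.-group H.
Proof. by rewrite /pgroup card_part_kernel pnatM pn. Qed.

Lemma sylow_sub : P \subset G. Proof. exact: pHall_sub sylP. Qed.

Lemma sylow_card : #|P| = (p * (n * n))%N.
Proof.
rewrite (card_Hall sylP) oG mul_rearrange -2!mulnA partnM ?muln_gt0 ?q0 ?n0 ?p0 //.
rewrite (part_p'nat p'q) mul1n part_pnat_id ?mulnA ?(mulnC _ p) ?mulnA //.
by rewrite !pnatM pn pnat_id.
Qed.

(** The number of Sylow subgroups divides [|G : P| = p - 1] and is 1 modulo [p]. *)
Lemma sylow_normal : P <| G.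
Proof.
have sPN : P \subset 'N_G(P) by rewrite subsetI sylow_sub normG.
have D : (#|G : 'N_G(P)| %| p.-1)%N.
  rewrite -(dvdn_pmul2l (cardG_gt0 'N_G(P))) Lagrange ?subsetIl //.
  rewrite oG mul_rearrange (_ : p.-1 * n * n * p = #|P| * p.-1)%N; last first.
    by rewrite sylow_card mulnC -!mulnA (mulnC p.-1) -!mulnA.
  by rewrite dvdn_pmul2r // cardSg.
have := card_Syl_mod G pr; rewrite (card_Syl sylP) modn_small; last first.
  by rewrite -(prednK p0) ltnS dvdn_leq.
move/eqP; rewrite indexg_eq1 => sGN.
by rewrite /normal sylow_sub; apply: subset_trans sGN (subsetIr _ _).
Qed.

Lemma kernel_sub_sylow : H \subset P.
Proof.
have [x Gx] := Sylow_subJ sylP (normal_sub kernel_normal) kernel_pgroup.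
by rewrite (normP (subsetP (normal_norm sylow_normal) _ Gx)).
Qed.

Lemma sylow_compl : P * <[g]> = G.
Proof.
have [_ og] := order_constt_vertex.
apply/eqP; rewrite eqEcard mul_subG ?sylow_sub ?cycle_subG ?(subsetP sAG) ?cycle_constt //=.
rewrite TI_cardMg; last first.
  by apply: coprime_TIg; rewrite -orderE og sylow_card; apply: pnat_coprime p'q; rewrite !pnatM pn pnat_id.
by rewrite sylow_card -orderE og oG mul_rearrange2.
Qed.

End PrimeParts.

(** * The exponent of the kernel *)

(** By nilpotency, each commutator with [Q] strictly shrinks a nontrivial normal subgroup, and order
    at most [p^2] leaves room for only two drops. *)
Lemma comm_comm_trivial (gT : finGroupType) (p : nat) (Q X : {group gT}) :
  prime p -> p.-group Q -> X \subset Q -> Q \subset 'N(X) -> (#|X| <= p ^ 2)%N ->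
  [~: [~: X, Q], Q] = 1.
Proof.
move=> pr pQ sXQ nXQ leX; have p1 := prime_gt1 pr.
have nilQ := pgroup_nil pQ.
case: (eqVneq (X : {set gT}) 1) => [->|ntX]; first by rewrite !comm1G.
have sNX : Q \subset 'N_Q(X) by rewrite subsetI subxx.
have pr1 := nil_comm_properl nilQ sXQ ntX sNX.
case: (eqVneq [~: X, Q] 1) => [->|ntY]; first by rewrite comm1G.
have sYQ : [~: X, Q] \subset Q by apply: subset_trans (proper_sub pr1) sXQ.
have sNY : Q \subset 'N_Q([~: X, Q]) by rewrite subsetI subxx commg_normr.
have pr2 := nil_comm_properl nilQ sYQ ntY sNY.
have [k ek] := p_natP (pgroupS sXQ pQ).
have [i ei] := p_natP (pgroupS sYQ pQ).
have sZQ := subset_trans (proper_sub pr2) sYQ.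
have [l el] := p_natP (pgroupS sZQ pQ).
have := proper_card pr2; have := proper_card pr1; move: leX.
rewrite ek ei el leq_exp2l // !ltn_exp2l // => k2 ik li.
have l0 : l = 0%N by apply/eqP; rewrite -leqn0 -ltnS; apply: leq_trans li (leq_trans ik k2).
by apply/eqP; rewrite trivg_card1 el l0.
Qed.

Section ExponentOne.
Variables (gT : finGroupType) (p e : nat) (P H : {group gT}) (w c : gT).
Hypotheses (pr : prime p) (p5 : (5 <= p)%N) (pP : p.-group P) (nHP : H <| P).
Hypotheses (abH : abelian H) (Hw : w \in H) (Pc : c \in P) (Hcp : c ^+ p \in H).
Hypotheses (ow : #[w] = (p ^ e)%N) (TI : <[w]> :&: <[w ^ c]> = 1).
Hypothesis (oH : #|H| = (p ^ e * p ^ e)%N).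

Let z := [~ w, c].

Let Hc u : u \in H -> u ^ c \in H.
Proof. by rewrite memJ_norm // (subsetP (normal_norm nHP)). Qed.

Let HR u : u \in H -> [~ u, c] \in H.
Proof. by move=> Hu; rewrite commgEl groupM ?groupV ?Hc. Qed.

Let comH u v : u \in H -> v \in H -> commute u v.
Proof. by move=> Hu Hv; apply: (centsP abH). Qed.

Let HE : H = <[w]> * <[w ^ c]> :> {set gT}.
Proof.
apply/esym/eqP; rewrite eqEcard mul_subG ?cycle_subG ?Hc //=.
by rewrite TI_cardMg // oH -!orderE orderJ ow.
Qed.

Let commE u : u ^ c = u * [~ u, c].
Proof. by rewrite commgEl mulKVg. Qed.

(* [H] is generated by two elements, so [P] acts unipotently of class at most 2 on [H / H^p]. *)
Let comm2_pth_power u : u \in H -> exists2 v, v \in H & [~ u, c, c] = v ^+ p.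
Proof.
move=> Hu; have pH := pgroupS (normal_sub nHP) pP.
pose M := 'Mho^1(H)%G.
have ME : M = [set x ^+ p | x in H] :> {set gT}.
  by rewrite /M /= (MhoEabelian 1 pH abH).
have nMP : P \subset 'N(M) by apply: char_norm_trans (Mho_char 1 H) (normal_norm nHP).
have sHP := normal_sub nHP.
have qle x : x \in H -> (#[coset M x] <= p)%N.
  move=> Hx; apply: dvdn_leq (prime_gt0 pr) _.
  have Nx : x \in 'N(M) by apply: (subsetP nMP); apply: (subsetP sHP).
  rewrite order_dvdn -morphX //; apply/eqP/coset_id; rewrite ME.
  exact: imset_f.
have lX : (#|H / M| <= p ^ 2)%N.
  have -> : H / M = <[coset M w]> * <[coset M (w ^ c)]>.
    by rewrite HE quotientMl ?quotient_cycle ?cycle_subG ?(subsetP nMP) ?(subsetP sHP) ?Hc.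
  have := mul_cardG <[coset M w]> <[coset M (w ^ c)]>.
  move/eqP; rewrite -!orderE /= => /eqP E.
  apply: (@leq_trans (#[coset M w] * #[coset M (w ^ c)])); last by rewrite leq_mul ?qle ?Hc.
  by rewrite E leq_pmulr ?cardG_gt0.
have := comm_comm_trivial pr (quotient_pgroup M pP) (quotientS M sHP)
  (quotient_norms M (normal_norm nHP)) lX.
rewrite -!quotientR ?(subset_trans sHP) ?comm_subG ?(subset_trans sHP) // => /trivgP.
rewrite quotient_sub1; last by rewrite !comm_subG ?(subset_trans sHP).
move/subsetP/(_ [~ u, c, c]); rewrite /= ME !mem_commg // => /(_ isT).
by case/imsetP=> v; exists v.
Qed.

(** The conjugates [w^(c^m)] are tracked up to [m = p], where [c^p] lies in the abelian group [H]
    and fixes [w]. *)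
Lemma homocyclic_exponent : (e <= 1)%N.
Proof.
have Hz : z \in H by apply: HR.
have [v Hv ev] := comm2_pth_power Hw.
pose v3 := [~ v, c]; have Hv3 : v3 \in H by apply: HR.
have [s2 Hs2 es2] := comm2_pth_power Hv.
(* As [[z, c] = v^p], conjugating [z^m] by [c] adds the factor [v^(p m)]; [r] accumulates the [p]-th
   roots of these corrections. *)
pose r := fix r m := if m is m'.+1 then v ^+ m' * r m' ^ c else 1.
have Hr m : r m \in H.
  by elim: m => [|m IHm] /=; rewrite ?group1 // groupM ?groupX ?Hc.
have wE m : w ^ (c ^+ m) = w * z ^+ m * r m ^+ p.
  elim: m => [|m IHm]; first by rewrite conjg1 expg1n !mulg1.
  rewrite expgSr conjgM IHm !conjMg !conjXg commE -/z (commE z) ev.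
  rewrite expgMn; last by apply: comH; rewrite ?groupX.
  rewrite /= [(v ^+ m * _) ^+ p]expgMn; last by apply: comH; rewrite ?groupX ?Hc.
  by rewrite expgAC expgS !mulgA.
(* Here [v^c = v v3] and [v3^c = v3 s2^p], so the exponents follow Pascal's rule up to a [p]-th
   power. *)
have rE m : exists2 s, s \in H & r m = v ^+ 'C(m, 2) * v3 ^+ 'C(m, 3) * s ^+ p.
  elim: m => [|m [s Hs IHm]]; first by exists 1; rewrite // expg1n !mulg1.
  exists (s2 ^+ 'C(m, 3) * s ^ c); first by rewrite groupM ?groupX ?Hc.
  rewrite /= IHm !conjMg !conjXg commE -/v3 (commE v3) es2.
  rewrite expgMn; last by apply: comH.
  rewrite [(v3 * _) ^+ _]expgMn; last by apply: comH; rewrite ?groupX.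
  rewrite [(_ * s ^ c) ^+ p]expgMn; last by apply: comH; rewrite ?groupX ?Hc.
  rewrite !binS bin1 addnC !expgD expgAC !mulgA.
  by do 2 congr (_ * _); rewrite -!mulgA -!(expgD v3) addnC.
(* For [p >= 5] both ['C(p, 2)] and ['C(p, 3)] are multiples of [p]. *)
have [x Hx ex] : exists2 x, x \in H & r p = x ^+ p.
  have [s Hs ->] := rE p.
  have /dvdnP[i ->] : (p %| 'C(p, 2))%N by apply: prime_dvd_bin => //; apply: leq_trans p5.
  have /dvdnP[k ->] : (p %| 'C(p, 3))%N by apply: prime_dvd_bin => //; apply: leq_trans p5.
  exists (v ^+ i * v3 ^+ k * s); first by rewrite !groupM ?groupX.
  rewrite [RHS]expgMn; last by apply: comH; rewrite ?groupM ?groupX.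
  rewrite [(_ * v3 ^+ k) ^+ p]expgMn; last by apply: comH; rewrite ?groupX.
  by rewrite -!expgM.
pose u := w ^ c; have Hu : u \in H by apply: Hc.
have zp : z ^+ p * x ^+ (p * p) = 1.
  apply: (mulgI w); rewrite mulgA expgM -ex -wE mulg1.
  by apply/conjg_fixP/commgP/comH.
have [i [k ei]] : exists i k, x = w ^+ i * u ^+ k.
  by move: Hx; rewrite HE => /mulsgP[_ _ /cycleP[i ->] /cycleP[k ->] ->]; exists i, k.
(* Since [z = w^-1 u], this is the [u]-component of [zp]. It must be trivial, so [p^e] divides
   [p (1 + k p)]. *)
have : u ^+ (p + k * (p * p)) \in <[w]> :&: <[u]>.
  rewrite inE mem_cycle andbT expgD.
  suff -> : u ^+ p * u ^+ (k * (p * p)) = w ^+ p * (w ^+ (i * (p * p)))^-1.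
    by rewrite groupM ?groupV ?mem_cycle.
  apply: (mulIg (w ^+ (i * (p * p)))); rewrite mulgKV.
  apply: (mulgI (w ^- p)); rewrite mulVg -[RHS]zp /z commgEl -/u.
  rewrite ei; move: (u) Hu => u' Hu'.
  rewrite !expgMn; try by apply: comH; rewrite ?groupV ?groupX.
  rewrite expVgn -!expgM -!mulgA; do 2 congr (_ * _).
  by apply: comH; rewrite groupX.
rewrite TI => /set1P/eqP; rewrite -order_dvdn orderJ ow.
rewrite (_ : p + k * (p * p) = (1 + k * p) * p)%N; last by rewrite mulnDl mul1n mulnA.
move=> dv.
rewrite leqNgt; apply/negP=> e2.
have : (p * p %| (1 + k * p) * p)%N by apply: dvdn_trans dv; rewrite mulnn dvdn_exp2l.
rewrite dvdn_pmul2r ?prime_gt0 // dvdn_addl ?dvdn_mull // dvdn1 => /eqP p1.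
by move: pr; rewrite p1.
Qed.

End ExponentOne.

(** * Recovering the presentation *)

(** On [P / H], cyclic of order [p], [g1] acts as a power [r]. Faithfulness makes [r] a primitive
    root, so [t] is [r^i] with [i] prime to [p - 1], and [g1^i] is the desired generator. *)
Lemma choose_generator (gT : finGroupType) (p t : nat) (P H : {group gT}) (c g1 : gT) :
  prime p -> primitive_root_of_unity p.-1 (t%:R : 'F_p)%R ->
  H <| P -> #|P : H| = p -> g1 \in 'N(P) -> g1 \in 'N(H) ->
  c \in P -> c \notin H -> #[g1] = p.-1 ->
  (forall x, x \in <[g1]> -> [~ c, x] \in H -> x = 1) ->
  exists i j : nat, [/\ coprime i p.-1, unit_mod p.-1 j, g1 = (g1 ^+ i) ^+ j &
    exists2 h, h \in H & c ^ (g1 ^+ i) = c ^+ t * h].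
Proof.
move=> pr tprim nHP iP nPg nHg Pc nHc og faith.
have q0 : (0 < p.-1)%N by case: (p) pr => [|[|[]]].
have nHc' : c \in 'N(H) by apply: (subsetP (normal_norm nHP)).
have nHgX i : g1 ^+ i \in 'N(H) by rewrite groupX.
pose cb := coset H c; pose gb := coset H g1.
have oPH : #|P / H| = p by rewrite card_quotient ?normal_norm.
have cb1 : cb != 1 by apply: contra nHc => /eqP/coset_idr->.
have PHcb : cb \in P / H by apply: mem_quotient.
have ocb : #[cb] = p.
  by apply/prime_nt_dvdP; rewrite ?order_eq1 // -oPH order_dvdG.
have PHE : P / H = <[cb]>.
  by apply/esym/eqP; rewrite eqEcard cycle_subG PHcb oPH -orderE ocb leqnn.
have [r er] : exists r, cb ^ gb = cb ^+ r.
  have : cb ^ gb \in P / H.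
    rewrite memJ_norm ?mem_quotient //; apply: (subsetP (quotient_norms H (_ : <[g1]> \subset 'N(P)))).
      by rewrite cycle_subG.
    by rewrite mem_quotient ?cycle_id.
  by rewrite PHE => /cycleP[r ->]; exists r.
have act i : cb ^ (gb ^+ i) = cb ^+ (r ^ i).
  elim: i => [|i IHi]; first by rewrite conjg1.
  by rewrite expgSr conjgM IHi conjXg er -expgM expnS.
have actc i m : (r ^ i == m %[mod p])%N -> exists2 h, h \in H & c ^ (g1 ^+ i) = c ^+ m * h.
  rewrite -ocb -eq_expg_mod_order -act /cb /gb -morphX // -morphJ // -morphX // => /eqP E.
  exists (c ^- m * c ^ (g1 ^+ i)); last by rewrite mulKVg.
  have Nm : c ^+ m \in 'N(H) by rewrite groupX.
  have Nc : c ^ (g1 ^+ i) \in 'N(H) by rewrite groupJ.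
  apply: coset_idr; first by rewrite groupM ?groupV.
  by rewrite morphM ?groupV // morphV //= E mulVg.
have key i : (r ^ i == 1 %[mod p])%N -> (p.-1 %| i)%N.
  case/actc=> h Hh; rewrite expg1 => E; rewrite -og order_dvdn; apply/eqP.
  by apply: faith; rewrite ?mem_cycle // commgEl E mulKg.
pose x : 'F_p := (r%:R)%R.
have xE i m : ((x ^+ i)%R == (m%:R)%R) = (r ^ i == m %[mod p])%N.
  by rewrite -GRing.natrX -(inj_eq val_inj) /= !val_Fp_nat.
have x1 i : (x ^+ i == 1)%R = (r ^ i == 1 %[mod p])%N by rewrite -(xE i 1%N).
have xq : (x ^+ p.-1 = 1)%R.
  apply/eqP; rewrite x1.
  have := eq_expg_mod_order cb (r ^ p.-1) 1; rewrite ocb => <-.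
  by rewrite -act -og -morphX // expg_order morph1 conjg1 expg1.
(* The order of [x] divides [p - 1] by [xq], and is a multiple of it by [key]. *)
have xprim : primitive_root_of_unity p.-1 x.
  have [m prm md] := prim_order_exists q0 xq.
  have /eqP := prim_expr_order prm; rewrite x1 => /key dm.
  by have -> : p.-1 = m by apply/eqP; rewrite eqn_dvd dm.
have [i ei] := prim_rootP xprim (prim_expr_order tprim).
have copi : coprime i p.-1 by rewrite -(prim_root_exp_coprime _ xprim) -ei.
have geni : <[g1 ^+ i]> = <[g1]>.
  apply/esym/eqP; rewrite [_ == _]generator_coprime og coprime_sym.
  exact: copi.
have [j jlt ej] : exists2 j, (j < p.-1)%N & g1 = (g1 ^+ i) ^+ j.
  have : g1 \in <[g1 ^+ i]> by rewrite geni cycle_id.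
  by case/cyclePmin=> j; rewrite orderE geni -orderE og => lj e; exists j.
exists i, j; split=> //.
  have og2 : #[g1 ^+ i] = p.-1 by rewrite orderE geni -orderE.
  rewrite /unit_mod jlt coprime_sym -og2 -generator_coprime -ej /generator geni.
  by rewrite eqxx.
by apply: actc; rewrite -xE -ei.
Qed.

Section RelationsFromAction.
Variables (gT : finGroupType) (p t : nat) (P H : {group gT}) (w c g h : gT).
Hypotheses (pr : prime p) (p5 : (5 <= p)%N).
Hypothesis tprim : primitive_root_of_unity p.-1 (t%:R : 'F_p)%R.
Hypotheses (pP : p.-group P) (expP : exponent P = p).
Hypotheses (nHP : H <| P) (abH : abelian H) (oH : #|H| = (p * p)%N).
Hypotheses (Hw : w \in H) (Pc : c \in P).
Hypotheses (ow : #[w] = p) (TI : <[w]> :&: <[w ^ c]> = 1).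
Hypotheses (gq : g ^+ p.-1 = 1) (wg : w ^ g = w).
Hypotheses (Hh : h \in H) (cg : c ^ g = c ^+ t * h).
Hypothesis (cgV : c ^ (g ^+ (p.-1 %/ 2)) = c^-1).

Let z := [~ w, c].

Let Hc u : u \in H -> u ^ c \in H.
Proof. by rewrite memJ_norm // (subsetP (normal_norm nHP)). Qed.

Let Hz : z \in H.
Proof. by rewrite /z commgEl groupM ?groupV ?Hc. Qed.

Let comH u v : u \in H -> v \in H -> commute u v.
Proof. by move=> Hu Hv; apply: (centsP abH). Qed.

Let wc : w ^ c = w * z.
Proof. by rewrite /z commgEl mulKVg. Qed.

Let zc : z ^ c = z.
Proof.
apply/conjg_fixP; rewrite -in_set1 -set1gE.
rewrite -(comm_comm_trivial pr pP (normal_sub nHP) (normal_norm nHP)) ?oH ?mulnn //.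
by rewrite !mem_commg.
Qed.

Let expg_p u : u \in P -> u ^+ p = 1.
Proof. by move=> Pu; rewrite -expP expg_exponent. Qed.

Let sHP := subsetP (normal_sub nHP).

Let HE : H = <[w]> * <[z]> :> {set gT}.
Proof.
have E : H = <[w]> * <[w ^ c]> :> {set gT}.
  apply/esym/eqP; rewrite eqEcard mul_subG ?cycle_subG ?Hc //=.
  by rewrite TI_cardMg // oH -!orderE orderJ ow.
apply/eqP; rewrite eqEsubset mul_subG ?cycle_subG ?Hz // andbT.
apply/subsetP=> u; rewrite E => /mulsgP[_ _ /cycleP[i ->] /cycleP[k ->] ->].
by rewrite wc expgMn ?mulgA ?mem_mulg ?mem_cycle -?expgD ?mem_cycle //; apply: comH.
Qed.

Let wz : #[z] = p /\ <[w]> :&: <[z]> = 1.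
Proof.
have p0 := prime_gt0 pr.
have := @mulg_card_TI _ <[w]>%G <[z]>%G p p p0 p0.
rewrite -HE oH -!orderE ow leqnn => /(_ isT) [] //.
by apply: dvdn_leq p0 _; rewrite order_dvdn expg_p ?sHP.
Qed.

Let w_conj m : w ^ (c ^+ m) = w * z ^+ m.
Proof.
elim: m => [|m IHm]; first by rewrite conjg1 mulg1.
by rewrite expgSr conjgM IHm conjMg conjXg wc zc -mulgA -expgS.
Qed.

Let z_conj_cX m : z ^ (c ^+ m) = z.
Proof.
by elim: m => [|m IHm]; rewrite ?conjg1 // expgSr conjgM IHm zc.
Qed.

(** Conjugating [[w, c]] by [g] gives [[w, c^t h]], and [h] centralises [H]. *)
Let zg : z ^ g = z ^+ t.
Proof.
rewrite {1}/z conjRg wg cg commgEl conjgM w_conj.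
have -> : (w * z ^+ t) ^ h = w * z ^+ t.
  by apply/conjg_fixP/commgP/comH; rewrite ?groupM ?groupX.
by rewrite mulKg.
Qed.

Let z_gX m : z ^ (g ^+ m) = z ^+ (t ^ m).
Proof.
elim: m => [|m IHm]; first by rewrite conjg1.
by rewrite expgSr conjgM IHm conjXg zg -expgM expnS.
Qed.

Let zgV : z ^ (g ^+ (p.-1 %/ 2)) = z^-1.
Proof.
rewrite z_gX; apply/eqP; rewrite eq_sym eq_invg_mul -expgS -order_dvdn.
by have [-> _] := wz; apply: prim_root_half.
Qed.

(* Conjugating [cg] by [g ^+ (p.-1 %/ 2)], which inverts [c] and [z] and fixes [w],
   shows that [h] has no [w]-component. *)
Let h_central : exists k, h = z ^+ k.
Proof.
have [oz TIwz] := wz.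
move: (Hh); rewrite HE => /mulsgP[_ _ /cycleP[i ->] /cycleP[k ->] eh].
exists k; suff w1 : w ^+ i = 1 by rewrite eh w1 mul1g.
set s := g ^+ (p.-1 %/ 2).
have ws : w ^ s = w.
  by apply/conjg_fixP/commgP/commuteX/commgP/conjg_fixP.
have hs : h ^ s = w ^+ i * z ^- k by rewrite eh conjMg !conjXg ws zgV expgVn.
have E1 : (c^-1) ^ g = (c^-1) ^+ t * h ^ s.
  rewrite -cgV -/s -conjXg -conjMg -cg -!conjgM.
  by congr (c ^ _); apply/commute_sym/commuteX.
have E2 : (h ^ s) ^ (c ^+ t) = h^-1.
  have : (c ^+ t * h)^-1 = c ^- t * h ^ s by rewrite -cg -conjVg E1 expgVn.
  by rewrite invMg => E; rewrite conjgE mulgA -E mulgKV.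
move: E2; rewrite hs eh conjMg conjXg conjVg conjXg w_conj z_conj_cX.
rewrite invMg (comH (groupVr (groupX k Hz)) (groupVr (groupX i Hw))) => /mulIg.
rewrite expgMn; last by apply: comH; rewrite ?groupX.
move=> E3.
have : w ^+ (i * 2) \in <[w]> :&: <[z]>.
  rewrite inE mem_cycle /= muln2 -addnn expgD.
  have -> : w ^+ i * w ^+ i = ((z ^+ t) ^+ i)^-1.
    by apply: (mulIg ((z ^+ t) ^+ i)); rewrite mulVg -mulgA E3 mulgV.
  by rewrite groupV !groupX ?cycle_id.
rewrite TIwz => /set1P/eqP; rewrite -order_dvdn ow Euclid_dvdM //.
case/orP=> [pi|/dvdn_leq]; last by move=> /(_ isT); move: p5; case: (p) => [|[|[|]]].
by apply/eqP; rewrite -order_dvdn ow.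
Qed.

(** What remains is to remove [h = z^k] from [c^g = c^t h]. Iterating the action up to [g^(p-1) = 1]
    gives [p] dividing [k (p - 1) t^(p-2)], hence [k]. *)
Lemma relations_of_action : G2_rels p t w z c g.
Proof.
have [oz TIwz] := wz; have [k hk] := h_central.
have comcz : commute (c ^+ t) z by apply/commute_sym/commuteX/commgP/conjg_fixP.
(* The shift to [m.+1] keeps a predecessor out of the exponent of [t]. *)
have c_gX m : c ^ (g ^+ m.+1) = c ^+ (t ^ m.+1) * z ^+ (k * m.+1 * t ^ m).
  elim: m => [|m IHm]; first by rewrite cg hk expn1 !muln1.
  rewrite expgSr conjgM IHm conjMg !conjXg zg cg hk.
  rewrite expgMn; last exact: commuteX.
  rewrite -!expgM -expnS -mulgA -expgD; congr (_ * z ^+ _).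
  by rewrite mulnCA -expnS -mulnDl -mulnS.
have q0 : (0 < p.-1)%N by case: (p) pr => [|[|[]]].
have ct : c ^+ (t ^ p.-1) = c.
  have /eqP E : (t ^ p.-1 == t ^ 0 %[mod p])%N by rewrite (prim_root_nat_eq _ _ pr tprim) modnn mod0n.
  have cp := expg_p Pc.
  by rewrite -(expg_mod _ cp) E expn0 expg_mod // expg1.
have : (p %| k * p.-1 * t ^ p.-2)%N.
  have := c_gX p.-2; rewrite prednK // gq conjg1 ct => E.
  by rewrite -[X in (X %| _)%N]oz order_dvdn; apply/eqP/(mulgI c); rewrite mulg1 -E.
rewrite !Euclid_dvdM // => /orP[/orP[|]|].
- move=> pk; have h1 : h = 1 by rewrite hk; apply/eqP; rewrite -order_dvdn oz.
  have cgt : c ^ g = c ^+ t by rewrite cg h1 mulg1.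
  have [wp zp cp] : [/\ w ^+ p = 1, z ^+ p = 1 & c ^+ p = 1].
    by split; apply: expg_p => //; apply: sHP.
  have cwz : [~ w, z] == 1 by apply/commgP/comH.
  by rewrite /G2_rels wp zp cp gq cwz cgt wc zc wg zg !eqxx.
- by move/(dvdn_leq q0); rewrite leqNgt prednK ?prime_gt0 // leqnn.
rewrite Euclid_dvdX // => /andP[pt _].
have : ((t%:R : 'F_p) == 0)%R by rewrite -(GRing.dvdn_pcharf (pchar_Fp pr)).
have := prim_expr_order tprim => t1 /eqP t0.
move: t1; rewrite t0 GRing.expr0n; case: (p.-1) q0 => //= _ _ /eqP.
Qed.

End RelationsFromAction.

(** * The classification of the embeddings *)

Section Classification.
Variables (p t e : nat) (gT : finGroupType) (a b : gT).
Variables (f : {set gT} -> 'I_p * 'I_(p ^ e)) (P : {group gT}).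
Hypotheses (pr : prime p) (p5 : (5 <= p)%N).
Hypothesis tprim : primitive_root_of_unity p.-1 (t%:R : 'F_p)%R.
Hypotheses (e1 : (1 <= e)%N) (ob : #[b] = 2%N) (emb : Kmn_embedding a b f).
Hypotheses (abS : abelian (part_stabilizer a b f)) (sylP : p.-Sylow(mapG a b) P).
Hypothesis (expP : exponent P = (p ^ e)%N).

Let G := mapG a b.
Let S := base_part_group emb.
Let H := [group of gcore S G].
Let w := a.`_p.
Let g1 := a.`_p^'.
Let h := (p.-1 %/ 2)%N.
Let s := g1 ^+ h.
Let c := b * s^-1.

Let half : p.-1 = (2 * h)%N.
Proof. by rewrite /h; case: (even_prime pr) => [p2|]; [move: p5; rewrite p2|lia]. Qed.

Let ow : #[w] = (p ^ e)%N. Proof. by case: (order_constt_vertex pr emb). Qed.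
Let og : #[g1] = p.-1. Proof. by case: (order_constt_vertex pr emb). Qed.

Let ss : s * s = 1.
Proof. by rewrite -expgD addnn -mul2n -half -og expg_order. Qed.

Let bb : b * b = 1.
Proof. by have := expg_order b; rewrite ob. Qed.

Let Ag1 : g1 \in <[a]>. Proof. exact: cycle_constt. Qed.
Let As : s \in <[a]>. Proof. exact: groupX. Qed.
Let Gb : b \in G. Proof. exact: flip_mem. Qed.
Let nPG : G \subset 'N(P). Proof. exact: normal_norm (sylow_normal pr emb sylP). Qed.
Let sAG : <[a]> \subset G. Proof. exact: vertex_stab_sub. Qed.
Let nHG : H <| G. Proof. exact: kernel_normal. Qed.
Let pP : p.-group P. Proof. exact: pHall_pgroup sylP. Qed.

Let p_compl_TI x : x \in P -> x \in <[g1]> -> x = 1.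
Proof.
move=> Px gx; apply/set1P; rewrite -set1gE.
rewrite -(coprime_TIg (_ : coprime #|P| #|<[g1]>|)) ?inE ?Px //.
have q0 : (0 < p.-1)%N by case: (p) pr => [|[|[]]].
have p'q : p^'.-nat p.-1 by rewrite p'natE // gtnNdvd // prednK // prime_gt0.
by rewrite -orderE og; apply: pnat_coprime pP p'q.
Qed.

Let bE : b = c * s. Proof. by rewrite /c mulgKV. Qed.

(* Modulo [P] the group is cyclic of even order, and [g1 ^+ h] is its only involution. *)
Let Pc : c \in P.
Proof.
have := Gb; rewrite -[gval G](sylow_compl pr emb sylP).
case/mulsgP=> x y Px gy exy; rewrite /c exy.
suff -> : y = s by rewrite mulgK.
have Gy : y \in G.
  by apply: (subsetP sAG); apply: (subsetP _ _ gy); rewrite cycle_subG.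
have yy : y * y = 1.
  apply: p_compl_TI; last by rewrite groupM.
  have -> : y * y = (x * x ^ y^-1)^-1.
    apply/eqP; rewrite eq_sym eq_invg_mul conjgE invgK.
    by rewrite !mulgA mulgKV -!mulgA (mulgA x) -exy bb.
  by rewrite groupV groupM // memJ_norm // groupV (subsetP nPG).
case/cycleP: gy => k ek.
have : (p.-1 %| k + k)%N by rewrite -og order_dvdn expgD -ek yy.
rewrite half addnn -mul2n dvdn_pmul2l // => /dvdnP[m em].
have ym : y = s ^+ m by rewrite ek em mulnC expgM.
move: ym; rewrite -(odd_double_half m) expgD -mul2n expgM.
have -> : s ^+ 2 = 1 by rewrite expgS expg1 ss.
rewrite expg1n mulg1; case: (odd m) => //; rewrite ?expg1 // expg0 => y1.
have Pb : b \in P by rewrite exy y1 mulg1.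
have := pnat_dvd (order_dvdG Pb) pP; rewrite ob pnatE // => /eqP p2.
by move: p5; rewrite -p2.
Qed.

Let nSc : c \notin S.
Proof.
apply: contra (flip_notin emb) => Sc.
have : c * s \in S by rewrite groupM // (subsetP (vertex_stab_base_part emb)).
by rewrite -bE.
Qed.

Let nHc : c \notin H.
Proof. by apply: contra nSc; apply: (subsetP (kernel_sub emb)). Qed.

Let sHP : H \subset P. Proof. exact: kernel_sub_sylow. Qed.

Let nHP : H <| P.
Proof. by rewrite /normal sHP (subset_trans (sylow_sub sylP)) // normal_norm. Qed.

Let oH : #|H| = (p ^ e * p ^ e)%N. Proof. exact: (card_part_kernel pr emb). Qed.

Let iP : #|P : H| = p.
Proof.
apply/eqP; rewrite -(eqn_pmul2l (cardG_gt0 H)) Lagrange // (sylow_card pr emb sylP) oH.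
by rewrite mulnC.
Qed.

Let Gc : c \in G. Proof. exact: (subsetP (sylow_sub sylP)). Qed.

(** The hypothesis puts [x^c] in [S], so [x] lies in [A :&: S^(c^-1) = <[w]>]. It is then both a
    p-element and a p'-element. *)
Let faithful_on_quotient x : x \in <[g1]> -> [~ c, x] \in H -> x = 1.
Proof.
move=> gx Hcx; have Ax : x \in <[a]> by apply: (subsetP _ _ gx); rewrite cycle_subG.
have Sx := subsetP (vertex_stab_base_part emb) _ Ax.
have : x \in <[a]> :&: S :^ c^-1.
  rewrite inE Ax mem_conjg invgK -groupV -conjVg -(groupMr _ Sx).
  apply: (subsetP (kernel_sub emb)); rewrite -/H.
  by rewrite -commgEr.
rewrite (vertex_stab_conj pr) ?groupV // => wx.
apply: p_compl_TI => //; apply: (subsetP sHP); apply: (subsetP _ _ wx).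
exact: w_sub_kernel.
Qed.

(** Conjugation by [s], an element of [A], moves this intersection into [A :&: A^b]. *)
Let TIw : <[w]> :&: <[w ^ c]> = 1.
Proof.
have sWA : <[w]> \subset <[a]> by rewrite cycle_subG cycle_constt.
apply/trivgP; rewrite /= -(conjSg _ _ s) (cycleJ w c) conjs1g conjIg -conjsgM -bE.
rewrite -(arc_stab_TI emb) setISS ?conjSg //.
have E : <[a]> :^ s = <[a]> := conjGid As.
by apply: (@subset_trans _ _ (<[a]> :^ s)); rewrite ?conjSg // E.
Qed.

Let abH : abelian H.
Proof. by move: abS; rewrite (part_stabilizerE emb). Qed.

Let Hw : w \in H.
Proof. by rewrite -cycle_subG w_sub_kernel. Qed.

Let Hcp : c ^+ p \in H.
Proof.
have Nc : c \in 'N(H) by apply: (subsetP (normal_norm nHP)).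
apply: coset_idr; first exact: groupX.
rewrite morphX //; apply/eqP; rewrite -order_dvdn -[X in (_ %| X)%N]iP.
by rewrite -card_quotient ?normal_norm // order_dvdG // mem_quotient.
Qed.

Let exponent_one : e = 1%N.
Proof.
apply/eqP; rewrite eqn_leq e1 andbT.
exact: (homocyclic_exponent pr p5 pP nHP abH Hw Pc Hcp ow TIw oH).
Qed.

Lemma classification : exists2 j, unit_mod p.-1 j & isoM2 p t j a b.
Proof.
have ge : (p ^ e)%N = p by rewrite exponent_one expn1.
have Gg1 : g1 \in G by apply: (subsetP sAG).
have [i [j [copi uj ej [h0 Hh0 cg]]]] := choose_generator pr tprim nHP iP
  (subsetP nPG _ Gg1) (subsetP (normal_norm nHG) _ Gg1) Pc nHc og faithful_on_quotient.
exists j => //; apply/(isoM2P _ _ _ pr tprim).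
set g := g1 ^+ i in ej cg *.
have gq : g ^+ p.-1 = 1 by rewrite -expgM mulnC expgM -og expg_order expg1n.
(* The exponent [i] is odd, being prime to the even number [p - 1], so [s^i = s]. *)
have gh : g ^+ h = s.
  rewrite /g -expgM mulnC expgM -/s -(odd_double_half i) expgD -mul2n expgM.
  have -> : s ^+ 2 = 1 by rewrite expgS expg1 ss.
  move: copi; rewrite half coprimeMr coprimen2 => /andP[-> _].
  by rewrite expg1n mulg1 expg1.
have sV : s^-1 = s by apply/eqP; rewrite eq_invg_mul ss.
have cgV : c ^ (g ^+ h) = c^-1.
  rewrite gh; apply/eqP; rewrite eq_sym eq_invg_mul conjgE sV mulgA -bE.
  by rewrite bb.
have wg : w ^ g = w.
  apply/conjg_fixP/commgP/commuteX.
  exact: (centsP (cycle_abelian a) _ (cycle_constt _ _) _ Ag1).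
have ow' : #[w] = p by rewrite ow.
have oH' : #|H| = (p * p)%N by rewrite oH ge.
have expP' : exponent P = p by rewrite expP.
have rels := relations_of_action pr p5 tprim pP expP' nHP abH oH' Hw Pc ow' TIw gq wg Hh0 cg cgV.
have ea : a = w * g ^+ j by rewrite -ej consttC.
have eb : b = c * g ^+ h by rewrite gh -bE.
have Gw : w \in G by apply: (subsetP (normal_sub nHG)).
have Gg : g \in G by apply: groupX.
exists w, [~ w, c], c, g; split=> //.
  set M := <<_>>.
  have [Mw Mc Mg] : [/\ w \in M, c \in M & g \in M].
    by split; rewrite mem_gen // !inE eqxx ?orbT.
  have Ma : a \in M by rewrite ea; apply: groupM Mw (groupX j Mg).
  have Mb : b \in M by rewrite eb; apply: groupM Mc (groupX h Mg).
  apply/eqP; rewrite eqEsubset /= !gen_subG; apply/andP; split.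
    by rewrite !subUset !sub1set -/(gval G) Gw groupR // Gc.
  by rewrite subUset !sub1set Ma Mb.
by rewrite [#|_|](card_arcs emb) ge (mulnC p.-1).
Qed.

End Classification.

(** * Existence, uniqueness and properties of the maps *)

Lemma isoM2_exists p t j : prime p -> (5 <= p)%N ->
  primitive_root_of_unity p.-1 (t%:R : 'F_p)%R -> unit_mod p.-1 j ->
  exists (gT : finGroupType) (a b : gT), isoM2 p t j a b.
Proof.
move=> pr p5 tprim uj; have [gT [w [z [c [g [rels oG]]]]]] := G2_model pr tprim.
exists gT, (w * g ^+ j), (c * g ^+ (p.-1 %/ 2)); apply/(isoM2P _ _ _ pr tprim).
by exists w, z, c, g; split=> //; rewrite (G2_mapG pr p5 tprim uj rels oG).
Qed.

(** The derived subgroup and [a^p] do not depend on the chosen generators. Hence [a^p] acts on the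
    same [z] of order [p] as both [t^j1] and [t^j2]. *)
Lemma isoM2_inj p t (gT : finGroupType) (a b : gT) j1 j2 : prime p -> (5 <= p)%N ->
  primitive_root_of_unity p.-1 (t%:R : 'F_p)%R -> unit_mod p.-1 j1 -> unit_mod p.-1 j2 ->
  isoM2 p t j1 a b -> isoM2 p t j2 a b -> j1 = j2.
Proof.
move=> pr p5 tprim u1 u2.
move=> /(isoM2P _ _ _ pr tprim)[w [z [c [g [gen rels oG ea eb]]]]].
move=> /(isoM2P _ _ _ pr tprim)[w' [z' [c' [g' [gen' rels' oG' ea' eb']]]]].
rewrite -gen in oG; rewrite -gen' in oG'.
have [oz] : #[z] = p by have [[]] := G2_structure pr rels oG.
have [zG' z1] := G2_z_der1 pr p5 rels oG.
have k1 := G2_kernel_conj j1 pr rels oG (subsetP (G2_der1 pr p5 tprim u1 rels oG) _ zG').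
have zG2 : z \in <<[set w'; z'; c'; g']>>^`(1) by rewrite gen' -gen.
have k2 := G2_kernel_conj j2 pr rels' oG' (subsetP (G2_der1 pr p5 tprim u2 rels' oG') _ zG2).
move: k1; rewrite -ea ea' k2 => /esym/eqP.
rewrite eq_expg_mod_order oz (prim_root_nat_eq _ _ pr tprim).
by case/andP: u1 => l1 _; case/andP: u2 => l2 _; rewrite !modn_small // => /eqP.
Qed.

Lemma isoM2_properties p t (gT : finGroupType) (a b : gT) j : prime p -> (5 <= p)%N ->
  primitive_root_of_unity p.-1 (t%:R : 'F_p)%R -> unit_mod p.-1 j -> isoM2 p t j a b ->
  [/\ orreg_map a b, exists f : {set gT} -> 'I_p * 'I_p, Kmn_embedding a b f,
     chiral a b &
     map_type a b = (if p %% 4 == 1%N then (p * p.-1)%N else (p * p.-1 %/ 2)%N, (p * p.-1)%N)].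
Proof.
move=> pr p5 tprim uj /(isoM2P _ _ _ pr tprim)[w [z [c [g [gen rels oG -> ->]]]]].
rewrite -gen in oG; split.
- exact: (G2_orreg_map pr p5 tprim uj rels oG).
- exact: (G2_embedding pr p5 tprim uj rels oG).
- exact: (G2_chiral pr p5 tprim uj rels oG).
exact: (G2_map_type pr p5 tprim uj rels oG).
Qed.

Theorem theorem3p7 (p t : nat) :
  prime p -> (5 <= p)%N ->
  (primitive_root_of_unity p.-1 (t%:R : 'F_p)%R) ->
  (* classification *)
  [/\ (forall (e : nat) (gT : finGroupType) (a b : gT)
         (f : {set gT} -> 'I_p * 'I_(p ^ e)) (P : {group gT}),
         (1 <= e)%N ->
         orreg_map a b -> Kmn_embedding a b f ->
         abelian (part_stabilizer a b f) ->
         P \in 'Syl_p(mapG a b) -> exponent P = (p ^ e)%N ->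
         exists2 j, unit_mod p.-1 j & isoM2 p t j a b),
      (* the maps M_2(p,j) exist and are uniquely determined by j *)
      (forall j, unit_mod p.-1 j ->
         exists (gT : finGroupType) (a b : gT), isoM2 p t j a b),
      (forall (gT : finGroupType) (a b : gT) (j1 j2 : nat),
         unit_mod p.-1 j1 -> unit_mod p.-1 j2 ->
         isoM2 p t j1 a b -> isoM2 p t j2 a b -> j1 = j2) &
      (* properties of M_2(p,j) *)
      (forall (gT : finGroupType) (a b : gT) (j : nat),
         unit_mod p.-1 j -> isoM2 p t j a b ->
         [/\ orreg_map a b,
             exists f : {set gT} -> 'I_p * 'I_p, Kmn_embedding a b f,
             chiral a b &
             map_type a b =
               (if p %% 4 == 1%N then (p * p.-1)%N else (p * p.-1 %/ 2)%N, (p * p.-1)%N)])].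
Proof.
move=> pr p5 tprim; split.
- move=> e gT a b f P e1 [ob _] emb abS; rewrite inE => sylP expP.
  exact: (classification pr p5 tprim e1 ob emb abS sylP expP).
- by move=> j; apply: isoM2_exists.
- by move=> gT a b j1 j2; apply: isoM2_inj.
by move=> gT a b j; apply: isoM2_properties.
Qed.
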